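(* Let $f\colon X\to\mathbb{R}^2$, $X=[0,2\pi]\times[0,2\pi]$, have Fourier coefficients $\hat f(\omega)\in\mathbb{C}^2$, $\omega\in\mathbb{Z}^2$, normalised so that $$f(\pmb x)=\frac{1}{2\pi}\sum_{\omega\in\mathbb{Z}^2}\hat f(\omega)e^{i\omega\cdot\pmb x}.$$ Let $\pmb u=f(\pmb x)+\epsilon$, where $\pmb x$ is a random point of $X$ and $\epsilon\in\mathbb{R}^2$ is a random vector independent of $\pmb x$ with $\mathrm{E}[\epsilon]=0$ and $\mathrm{E}[\|\epsilon\|^2]=\sigma^2$. Let $K\ge 1$ be an integer, $\lambda\ge 0$ a real number, and $\mathcal{L}$ a constant-coefficient linear differential operator of order at most $d$ as specified in the context. Let $\mathcal{P}$ be the family of strictly positive probability distributions $\rho$ on $\mathbb{Z}^2$ such that, for $\omega=(\omega_1,\omega_2)\sim\rho$, $\mathrm{E}[|\omega_i|^m]<C$ for all $0\le m\le 4d$ and $i=1,2$, where $C$ is a fixed positive real number. Assume that the distribution $\omega\mapsto \|\hat f(\omega)\|\big/\sum_{\omega'\in\mathbb{Z}^2}\|\hat f(\omega')\|$ belongs to $\mathcal{P}$. For $\rho\in\mathcal{P}$ let $\pmb\omega=(\omega_1,\dots,\omega_K)$ be independent and identically distributed according to $\rho$, independent of $(\pmb x,\epsilon)$, and for $\pmb\beta=(\beta_1,\dots,\beta_K)\in(\mathbb{C}^2)^K=\mathbb{C}^{2K}$ let $$\beta(\pmb x)=\sum_{k=1}^K\beta_k e^{i\omega_k\cdot\pmb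 x},\qquad \ell(\beta(\pmb x),\pmb u)=\|\beta(\pmb x)-\pmb u\|^2+\lambda\|\mathcal{L}\beta\|^2 .$$ Then the following hold. (a) There is a constant $\overline{C}>0$, not depending on $\rho$, such that for every $\rho\in\mathcal{P}$ $$\mathrm{E}\left[\min_{\pmb\beta\in\mathbb{C}^{2K}}\mathrm{E}\left[\ell(\beta(\pmb x),\pmb u)\mid\pmb\omega\right]\right]\le\frac{1+\lambda\overline{C}}{(2\pi)^2K}\sqrt{\mathrm{E}\left[\frac{\|\hat f(\omega)\|^4}{\rho(\omega)^4}\right]}+\sigma^2-\frac{1}{K}\mathrm{E}\left[\|f(\pmb x)\|^2\right],$$ where on the right-hand side $\omega\sim\rho$. (b) Furthermore, this upper bound (the right-hand side of the inequality in (a), as a function of $\rho\in\mathcal{P}$) is minimised by the distribution $$\rho(\omega)=\frac{\|\hat f(\omega)\|}{\sum_{\omega'\in\mathbb{Z}^2}\|\hat f(\omega')\|},\qquad\omega\in\mathbb{Z}^2 .$$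
   Context: $\|\cdot\|$ applied to vectors in $\mathbb{R}^2$ or $\mathbb{C}^2$ is the Euclidean (Hermitian) norm. The operator $\mathcal{L}$ maps $\mathbb{C}^2$-valued functions on $X$ to $\mathbb{C}$-valued functions and has the form $\mathcal{L}=\sum_{m=1}^M c_m\,\partial_1^{\alpha_{m,1}}\partial_2^{\alpha_{m,2}}$ with nonnegative integers $\alpha_{m,1}+\alpha_{m,2}\le d$ and constant coefficients $c_m=(c_{m,1},c_{m,2})\in\mathbb{C}^2$ pairing with the two components of the function: for $\beta=(\beta^{(1)},\beta^{(2)})$, $$\mathcal{L}\beta=\sum_{m=1}^M\partial_1^{\alpha_{m,1}}\partial_2^{\alpha_{m,2}}\left(c_{m,1}\beta^{(1)}+c_{m,2}\beta^{(2)}\right).$$ For example, the divergence $\mathcal{L}\beta=\nabla\cdot\beta$ is of this form. The penalty is $\|\mathcal{L}\beta\|^2=\int_X\overline{\mathcal{L}\beta(\pmb x)}\,\mathcal{L}\beta(\pmb x)\,\mathrm{d}\pmb x$. In $\mathrm{E}[\ell(\beta(\pmb x),\pmb u)\mid\pmb\omega]$ the expectation is over $(\pmb x,\epsilon)$ with $\pmb\omega$ (and the coefficients $\pmb\beta$) held fixed; the outer expectation is over $\pmb\omega$. The expectation under the square root, $\mathrm{E}[\|\hat f(\omega)\|^4/\rho(\omega)^4]=\sum_{\omega\in\mathbb{Z}^2}\|\hat f(\omega)\|^4/\rho(\omega)^3$, may be $+\infty$. *)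

(* Defs.v *)
(* MathComp / MathComp-Analysis *)
From HB Require Import structures.
From mathcomp Require Import all_boot all_order all_algebra.
From mathcomp Require Import finmap complex.
From mathcomp Require Import all_classical all_reals all_analysis.
From mathcomp Require summability.

Set Implicit Arguments.
Unset Strict Implicit.
Unset Printing Implicit Defensive.

Import Order.TTheory GRing.Theory Num.Theory.
Import numFieldNormedType.Exports.

Local Open Scope classical_set_scope.
Local Open Scope complex_scope.
Local Open Scope ring_scope.

Section Vectors.
Variable R : realType.

Definition enorm (v : R * R) : R := Num.sqrt (v.1 ^+ 2 + v.2 ^+ 2).

(* Hermitian norm on C^2 (the library norm on a product is the sup norm). *)
Definition cnorm (v : R[i] * R[i]) : R :=
  Num.sqrt ((complex.Re v.1 ^+ 2 + complex.Im v.1 ^+ 2)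
            + (complex.Re v.2 ^+ 2 + complex.Im v.2 ^+ 2)).

Definition real_vec (v : R * R) : R[i] * R[i] := (v.1%:C, v.2%:C).

Definition square : set (R * R) := `[0, 2 * pi] `*` `[0, 2 * pi].

(* e^{i w.x} *)
Definition wave (w : int * int) (x : R * R) : R[i] :=
  let t := w.1%:~R * x.1 + w.2%:~R * x.2 in cos t +i* sin t.

(* The sum over Z^2 converges unconditionally, i.e. along the net of finite
   subsets of Z^2, to the real vector f x; its imaginary part tends to 0. *)
Definition fourier_expansion (f : R * R -> R * R)
    (fhat : int * int -> R[i] * R[i]) : Prop :=
  let S (c : int * int -> R[i]) (x : R * R) (A : {fset int * int}) : R[i] :=
    ((2 * pi)^-1)%:C * \sum_(w <- A) c w * wave w x in
  let converges (c : int * int -> R[i]) (x : R * R) (r : R) : Prop :=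
    ((fun A => complex.Re (S c x A)) @ summability.totally --> r) /\
    ((fun A => complex.Im (S c x A)) @ summability.totally --> (0 : R)) in
  forall x, square x ->
    converges (fun w => (fhat w).1) x (f x).1 /\
    converges (fun w => (fhat w).2) x (f x).2.

End Vectors.

Section DifferentialOperator.
Variable R : realType.
Local Notation C := R[i].

(* Partial derivatives, with real and imaginary parts differentiated
   separately. *)
Definition pd1 (g : R * R -> C) (x : R * R) : C :=
  derive1 (fun t => complex.Re (g (t, x.2))) x.1
  +i* derive1 (fun t => complex.Im (g (t, x.2))) x.1.

Definition pd2 (g : R * R -> C) (x : R * R) : C :=
  derive1 (fun t => complex.Re (g (x.1, t))) x.2
  +i* derive1 (fun t => complex.Im (g (x.1, t))) x.2.

Definition diff_op (M : nat) (alpha : 'I_M -> nat * nat) (c : 'I_M -> C * C)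
    (b : R * R -> C * C) (x : R * R) : C :=
  \sum_(m < M) iter (alpha m).1 pd1 (iter (alpha m).2 pd2
    (fun y => (c m).1 * (b y).1 + (c m).2 * (b y).2)) x.

(* The integrand is real; the real part only changes its type. *)
Definition sqnorm_square (g : R * R -> C) : R :=
  \int[(@lebesgue_measure R \x @lebesgue_measure R)%E]_(x in @square R)
    complex.Re ((g x)^* * g x).

Definition model (K : nat) (w : 'I_K -> int * int) (b : 'I_K -> C * C)
    (x : R * R) : C * C :=
  (\sum_(k < K) (b k).1 * wave (w k) x, \sum_(k < K) (b k).2 * wave (w k) x).

Definition loss (lambda : R) (L : (R * R -> C * C) -> R * R -> C)
    (b : R * R -> C * C) (x u : R * R) : R :=
  cnorm (b x - real_vec u) ^+ 2 + lambda * sqnorm_square (L b).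

End DifferentialOperator.

Section Distributions.
Variable R : realType.

(* E[g(w)] for w with law rho on Z^2; used for nonnegative g only. *)
Definition Erho (rho g : int * int -> R) : \bar R :=
  (\esum_(w in [set: int * int]) (g w * rho w)%:E)%E.

Definition admissible (d : nat) (C : R) (rho : int * int -> R) : Prop :=
  [/\ forall w, 0 < rho w,
      (\esum_(w in [set: int * int]) (rho w)%:E = 1)%E &
      forall m, (m <= 4 * d)%N ->
        (Erho rho (fun w => (`|w.1%:~R| ^+ m)%R) < C%:E)%E /\
        (Erho rho (fun w => (`|w.2%:~R| ^+ m)%R) < C%:E)%E].

(* If the sum of the norms is infinite, fine maps it to 0 and fourier_law is
   the zero function, which is never admissible. *)
Definition fourier_law (fhat : int * int -> R[i] * R[i]) (w : int * int) : R :=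
  cnorm (fhat w)
  / fine (\esum_(w' in [set: int * int]) (cnorm (fhat w'))%:E)%E.

End Distributions.

Section Probability.
Context d (T : measurableType d) (R : realType) (P : probability T R).

Definition independent d1 d2 (U : measurableType d1) (V : measurableType d2)
    (X : T -> U) (Y : T -> V) : Prop :=
  forall A B, measurable A -> measurable B ->
    P (X @^-1` A `&` Y @^-1` B) = (P (X @^-1` A) * P (Y @^-1` B))%E.

(* Z^2 carries the discrete sigma-algebra. Taking some of the A k full gives
   the product rule for every subfamily. *)
Definition iid (K : nat) (rho : int * int -> R)
    (w : 'I_K -> T -> int * int) : Prop :=
  [/\ forall k A, measurable (w k @^-1` A),
      forall k v, P (w k @^-1` [set v]) = (rho v)%:E &
      forall A : 'I_K -> set (int * int),
        P (\bigcap_k (w k @^-1` A k)) = (\prod_(k < K) P (w k @^-1` A k))%E].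

(* E[ loss | w ]: expectation over (x, eps), frequencies w and coefficients b
   held fixed. The random frequencies live on a second probability space, so
   they are independent of (x, eps) on the product of the two spaces. *)
Definition risk (lambda : R) (L : (R * R -> R[i] * R[i]) -> R * R -> R[i])
    (f : R * R -> R * R) (x eps : T -> R * R) (K : nat)
    (w : 'I_K -> int * int) (b : 'I_K -> R[i] * R[i]) : \bar R :=
  'E_P[fun t => loss lambda L (model w b) (x t) (f (x t) + eps t)].

Definition error_bound (lambda Cbar sigma : R) (f : R * R -> R * R)
    (fhat : int * int -> R[i] * R[i]) (x : T -> R * R) (K : nat)
    (rho : int * int -> R) : \bar R :=
  (((1 + lambda * Cbar) / ((2 * pi) ^+ 2 * K%:R))%:E
     * sqrte (Erho rho (fun w => (cnorm (fhat w) ^+ 4 / rho w ^+ 4)%R))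
   + (sigma ^+ 2)%:E
   - (K%:R^-1)%:E * 'E_P[fun t => (enorm (f (x t)) ^+ 2)%R])%E.

End Probability.

(* Main.v *)
Require Import Defs.
From HB Require Import structures.
From mathcomp Require Import all_boot all_order all_algebra.
From mathcomp Require Import finmap complex.
From mathcomp Require Import all_classical all_reals all_analysis.
From mathcomp Require Import measurable_realfun ring lra.
From mathcomp Require summability.

Set Implicit Arguments.
Unset Strict Implicit.
Unset Printing Implicit Defensive.

Import Order.TTheory GRing.Theory Num.Theory.
Import numFieldNormedType.Exports.

Local Open Scope classical_set_scope.
Local Open Scope ring_scope.

(** The bound is realised by one explicit choice of coefficients: random
    Fourier coefficients, importance-weighted so that the sampled model is an
    unbiased estimator of the field.

    Let a(v) = fhat(v) / (2 pi rho(v)) and take b_k = a(w_k) / K. At every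
    point y of the square the K terms a(w_k) e^(i w_k.y) are iid with mean
    f(y), so their average has mean square error
    (E |a(w)|^2 - |f(y)|^2) / K ([mean_square_average],
    [integral_misfit_sample]). The mean is identified with f(y) by dominated
    convergence along finite sets of frequencies, which is the unconditional
    convergence of the Fourier expansion ([Rintegral_countable_law]).
    Exchanging the integrals over the frequencies and over the sample point
    gives the expected misfit, and the noise adds sigma^2 exactly, because it
    is centred and independent of the point ([riskE]).

    For the penalty, a constant coefficient operator multiplies each wave by
    a polynomial in its frequency ([diff_op_model]), so that |L beta|^2 is at
    most (2 pi)^2 K times the sum over k of |b_k|^2 times a polynomial of
    degree 2 d in |w_k| ([sqnorm_sample_le]). The Cauchy-Schwarz inequality
    separates the ratio |fhat| / rho from this polynomial, whose second moment
    is controlled by the moments of order 4 d of an admissible rho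
    ([Erho_symbol_bound]). It also bounds E (|fhat| / rho)^2 by the square
    root of E (|fhat| / rho)^4.

    The minimum over the coefficients exists because the risk is a nonnegative
    quadratic function on a finite-dimensional real vector space
    ([quadratic_min]).

    For the optimality of the Fourier law, let S be the sum of all |fhat(v)|.
    The ratio y = |fhat| / rho has mean S under every rho, so E y^4 >= S^4,
    with equality when y is constant, that is when rho is proportional to
    |fhat| ([Erho_fourth_power_min]). *)

(** * Minimum of a nonnegative quadratic function *)
Lemma affine_ge0_slope0 (R : realType) (a c : R) :
  (forall t : R, 0 <= a * t + c) -> a = 0.
Proof.
move=> h; apply/eqP; case: (eqVneq a 0) => // a0.
have := h (- (c + 1) / a); rewrite mulrC divfK//; lra.
Qed.

Definition linear_form (R : realType) (V : lmodType R) (l : V -> R) : Prop :=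
  forall a u v, l (a *: u + v) = a * l u + l v.

Definition quadratic (R : realType) (V : lmodType R) (q : V -> R) : Prop :=
  exists (B : V -> V -> R) (l : V -> R) (c : R),
    [/\ forall u, linear_form (B u), forall u v, B u v = B v u, linear_form l &
        forall v, q v = B v v - 2 * l v + c].

Section QuadraticMinimum.
Variable R : realType.

Lemma linear_form0 (V : lmodType R) (l : V -> R) : linear_form l -> l 0 = 0.
Proof. by move=> h; have := h (-1) 0 0; rewrite scaler0 addr0; lra. Qed.

Lemma linear_formZ (V : lmodType R) (l : V -> R) : linear_form l ->
  forall a v, l (a *: v) = a * l v.
Proof.
by move=> h a v; rewrite -[a *: v]addr0 h linear_form0// addr0.
Qed.

Lemma linear_formD (V : lmodType R) (l : V -> R) : linear_form l ->
  forall u v, l (u + v) = l u + l v.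
Proof. by move=> h u v; rewrite -[u]scale1r h mul1r scale1r. Qed.

Lemma quadraticD (V : lmodType R) (p q : V -> R) :
  quadratic p -> quadratic q -> quadratic (fun v => p v + q v).
Proof.
move=> [B [l [c [Bl Bs ll E]]]] [B' [l' [c' [Bl' Bs' ll' E']]]].
exists (fun u v => B u v + B' u v), (fun v => l v + l' v), (c + c'); split.
- by move=> u a v w; rewrite Bl Bl'; ring.
- by move=> u v; rewrite Bs Bs'.
- by move=> a v w; rewrite ll ll'; ring.
- by move=> v; rewrite E E'; ring.
Qed.

Lemma quadraticZ (V : lmodType R) (k : R) (q : V -> R) :
  quadratic q -> quadratic (fun v => k * q v).
Proof.
move=> [B [l [c [Bl Bs ll E]]]].
exists (fun u v => k * B u v), (fun v => k * l v), (k * c); split.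
- by move=> u a v w; rewrite Bl; ring.
- by move=> u v; rewrite Bs.
- by move=> a v w; rewrite ll; ring.
- by move=> v; rewrite E; ring.
Qed.

Lemma quadratic_comp (V W : lmodType R) (h : {linear W -> V}) (q : V -> R) :
  quadratic q -> quadratic (fun w => q (h w)).
Proof.
move=> [B [l [c [Bl Bs ll E]]]].
exists (fun u v => B (h u) (h v)), (fun v => l (h v)), c; split => //.
- by move=> u a v w; rewrite linearP Bl.
- by move=> a v w; rewrite linearP ll.
Qed.

Lemma linear_form_sum (V : lmodType R) (l : V -> R) (I : Type) (r : seq I)
  (F : I -> V) : linear_form l -> l (\sum_(i <- r) F i) = \sum_(i <- r) l (F i).
Proof.
move=> ll; elim/big_ind2 : _ => //; first exact: linear_form0.
by move=> u a v b <- <-; rewrite linear_formD.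
Qed.

Lemma linear_form_rV n (l : 'rV[R]_n -> R) : linear_form l ->
  forall v, l v = (v *m \col_j l (delta_mx 0 j)) 0 0.
Proof.
move=> ll v; rewrite {1}(row_sum_delta v) linear_form_sum// !mxE.
by apply: eq_bigr => j _; rewrite linear_formZ// !mxE.
Qed.

(** Completing the square needs the linear part to lie in the row space of the
    Gram matrix A. It does: if A k = 0 and l k <> 0 then q would be affine and
    not constant on the line spanned by k, hence negative somewhere. *)
Lemma quadratic_rV_min n (q : 'rV[R]_n -> R) : quadratic q ->
  (forall v, 0 <= q v) -> exists v0, forall v, q v0 <= q v.
Proof.
move=> [B [l [c [Bl Bs ll E]]]] q0.
have B0 v : 0 <= B v v.
  rewrite leNgt; apply/negP => Bv.
  have h t : 0 <= t ^+ 2 * B v v + c.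
    have := q0 (t *: v); have := q0 ((- t) *: v); rewrite !E !(linear_formZ ll).
    by rewrite !(linear_formZ (Bl _)) ![B _ v]Bs !(linear_formZ (Bl _)); lra.
  (* here t >= 1, so that t ^ 2 >= t *)
  pose t := 1 + `|c| / - B v v.
  have t1 : 0 <= `|c| / - B v v by rewrite divr_ge0//; lra.
  have tB : t * B v v = B v v - `|c|.
    by rewrite /t mulrDl mul1r invrN mulrN mulNr divfK ?lt_eqF.
  have tt : t * (B v v - `|c|) <= 1 * (B v v - `|c|).
    by rewrite ler_wnM2r//; [have := normr_ge0 c; lra|rewrite /t; lra].
  have := h t; rewrite expr2 -mulrA tB; have := ler_norm c; lra.
pose A := \matrix_(i, j) B (delta_mx 0 j) (delta_mx 0 i) : 'M[R]_n.
pose b := \col_j l (delta_mx 0 j) : 'cV[R]_n.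
have BA u v : B u v = (v *m A *m u^T) 0 0.
  rewrite (linear_form_rV (Bl u)); rewrite -mulmxA; congr ((_ *m _) 0 0).
  apply/colP => j; rewrite !mxE Bs (linear_form_rV (Bl (delta_mx 0 j))) !mxE.
  by apply: eq_bigr => k _; rewrite !mxE Bs mulrC.
have lb v : l v = (v *m b) 0 0 by exact: linear_form_rV.
have Asym : A^T = A by apply/matrixP => i j; rewrite !mxE Bs.
have : (b^T <= A)%MS.
  (* each column k of the cokernel matrix of A spans a line on which q is affine *)
  rewrite submxE; apply/eqP/rowP => j; rewrite [RHS]mxE.
  pose k := (col j (cokermx A))^T.
  have Ak : A *m k^T = 0 by rewrite trmxK colE mulmxA mulmx_coker mul0mx.
  have kb : (b^T *m cokermx A) 0 j = l k.
    rewrite lb /k; move: (cokermx A) => W; rewrite !mxE.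
    by apply: eq_bigr => i _; rewrite !mxE mulrC.
  rewrite kb; suff : - 2 * l k = 0 by lra.
  apply: (@affine_ge0_slope0 _ _ c) => t; have := q0 (t *: k).
  have Bk : B k k = 0 by rewrite BA -mulmxA Ak mulmx0 mxE.
  rewrite E (linear_formZ (Bl _)) Bs (linear_formZ (Bl _)) Bk.
  by rewrite (linear_formZ ll); lra.
case/submxP => v0 v0E; exists v0 => v.
have lE u : l u = B v0 u.
  by rewrite lb BA -[b]trmxK v0E trmx_mul Asym mulmxA.
have -> : v = v0 + (v - v0) by rewrite addrC subrK.
move: (v - v0) => h; rewrite !E !lE (linear_formD (Bl _)) (linear_formD (Bl v0)).
rewrite ![B (_ + _) _]Bs (linear_formD (Bl v0)) (linear_formD (Bl h)).
by rewrite [B h v0]Bs; have := B0 h; lra.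
Qed.

Lemma quadratic_min m n (q : 'M[R]_(m, n) -> R) : quadratic q ->
  (forall v, 0 <= q v) -> exists v0, forall v, q v0 <= q v.
Proof.
move=> Qq q0.
have [u0 h] : exists u0, forall u : 'rV_(m * n), q (vec_mx u0) <= q (vec_mx u).
  by apply: quadratic_rV_min => //; exact: (quadratic_comp vec_mx).
by exists (vec_mx u0) => v; rewrite -(mxvecK v).
Qed.

End QuadraticMinimum.

(** * Square-integrable functions *)
Section SquareIntegrable.
Context d (T : measurableType d) (R : realType).
Variables (mu : {measure set T -> \bar R}) (D : set T).
Hypothesis mD : measurable D.

Definition square_integrable (g : T -> R) : Prop :=
  measurable_fun D g /\ mu.-integrable D (EFin \o (fun t => g t ^+ 2)).

Lemma le_square_integrable (g h : T -> R) : measurable_fun D g ->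
  mu.-integrable D (EFin \o h) -> (forall t, D t -> g t ^+ 2 <= h t) ->
  square_integrable g.
Proof.
move=> mg ih gh; split => //; apply: (le_integrable mD _ _ ih).
  exact/measurable_EFinP/measurable_funX.
move=> t Dt /=; rewrite lee_fin ger0_norm ?sqr_ge0//.
exact: le_trans (gh _ Dt) (ler_norm _).
Qed.

Lemma square_integrableM (g h : T -> R) :
  square_integrable g -> square_integrable h ->
  mu.-integrable D (EFin \o (fun t => g t * h t)).
Proof.
move=> [mg ig] [mh ih].
apply: (le_integrable mD _ _ (integrableD mD ig ih)) => /=.
  exact/measurable_EFinP/measurable_funM.
move=> t _; change (`|g t * h t|%:E <= `|g t ^+ 2 + h t ^+ 2|%:E)%E.
rewrite lee_fin normrM [leRHS]ger0_norm ?addr_ge0 ?sqr_ge0//.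
rewrite -(real_normK (num_real (g t))) -(real_normK (num_real (h t))).
have := sqr_ge0 (`|g t| - `|h t|).
have := mulr_ge0 (normr_ge0 (g t)) (normr_ge0 (h t)); nra.
Qed.

Lemma square_integrableZ (a : R) (g : T -> R) :
  square_integrable g -> square_integrable (fun t => a * g t).
Proof.
move=> [mg ig]; apply: (@le_square_integrable _ (fun t => a ^+ 2 * g t ^+ 2)).
- exact: measurable_funM.
- exact: (integrableZl mD (a ^+ 2) ig).
- by move=> t _; rewrite exprMn.
Qed.

Lemma square_integrableD (g h : T -> R) :
  square_integrable g -> square_integrable h ->
  square_integrable (fun t => g t + h t).
Proof.
move=> [mg ig] [mh ih].
have i2 := integrableZl mD 2 (integrableD mD ig ih).
apply: (@le_square_integrable _ (fun t => 2 * (g t ^+ 2 + h t ^+ 2))) => //.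
- exact: measurable_funD.
- move=> t _; have := sqr_ge0 (g t - h t); nra.
Qed.

Lemma square_integrableB (g h : T -> R) :
  square_integrable g -> square_integrable h ->
  square_integrable (fun t => g t - h t).
Proof.
move=> ig ih; have := square_integrableD ig (square_integrableZ (-1) ih).
by under eq_fun do rewrite mulN1r.
Qed.

(** Least squares: the polarised form is the integral of F u * F v. *)
Lemma quadratic_integral (V : lmodType R) (F : V -> T -> R) (y : T -> R) :
  (forall t, linear_form (F^~ t)) ->
  (forall v, square_integrable (F v)) -> square_integrable y ->
  quadratic (fun v => \int[mu]_(t in D) (F v t - y t) ^+ 2).
Proof.
move=> Fl iF iy.
exists (fun u v => \int[mu]_(t in D) (F u t * F v t)),
  (fun v => \int[mu]_(t in D) (y t * F v t)), (\int[mu]_(t in D) (y t ^+ 2)).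
have lin z : square_integrable z ->
    linear_form (fun v => \int[mu]_(t in D) (z t * F v t)).
  move=> iz a v w.
  rewrite -RintegralZl//; last exact: square_integrableM.
  rewrite -RintegralD//; last exact: square_integrableM.
    by apply: eq_Rintegral => t _; rewrite Fl; ring.
  exact: (integrableZl mD a (square_integrableM iz (iF v))).
split=> [u|u v||v]; [exact: lin| |exact: lin|].
  by apply: eq_Rintegral => t _; rewrite mulrC.
have iFF := square_integrableM (iF v) (iF v).
have iyF := square_integrableM iy (iF v).
have i2 : mu.-integrable D (EFin \o (fun t => 2 * (y t * F v t))).
  exact: (integrableZl mD 2 iyF).
rewrite -RintegralZl// -RintegralB// -RintegralD//; last 2 first.
- exact: (integrableB mD iFF i2).
- by case: iy.
by apply: eq_Rintegral => t _; ring.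
Qed.

Hypothesis muD : (mu D < +oo)%E.

Lemma square_integrable_cst (r : R) : square_integrable (fun=> r).
Proof.
split=> //; apply/integrableP; split; first exact: measurable_cst.
rewrite (eq_integral (cst (r ^+ 2)%:E)) => [|t _]; last first.
  by rewrite /= ger0_norm ?sqr_ge0.
by rewrite integral_cst// lte_mul_pinfty// lee_fin sqr_ge0.
Qed.

Lemma bounded_square_integrable (g : T -> R) (M : R) : measurable_fun D g ->
  (forall t, D t -> `|g t| <= M) -> square_integrable g.
Proof.
move=> mg gM; apply: (@le_square_integrable _ (fun=> M ^+ 2)) => //.
  by have [] := square_integrable_cst M.
move=> t Dt; rewrite -(real_normK (num_real (g t))).
by rewrite lerXn2r ?nnegrE ?gM//; exact: le_trans (gM _ Dt).
Qed.

Lemma square_integrable_integrable (g : T -> R) :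
  square_integrable g -> mu.-integrable D (EFin \o g).
Proof.
move=> ig; have := square_integrableM (square_integrable_cst 1) ig.
by under [X in integrable _ _ (_ \o X)]eq_fun do rewrite mul1r.
Qed.

Lemma square_integrable_sum (I : Type) (r : seq I) (g : I -> T -> R) :
  (forall i, square_integrable (g i)) ->
  square_integrable (fun t => \sum_(i <- r) g i t).
Proof.
move=> ig; elim: r => [|i r IHr].
  under eq_fun do rewrite big_nil; exact: square_integrable_cst.
under eq_fun do rewrite big_cons; exact: square_integrableD.
Qed.

End SquareIntegrable.

(** * Independence *)
Section Independence.
Context d (T : measurableType d) (R : realType) (P : probability T R).

(** Independence says that the joint law of X and Y agrees with the product of
    their laws on rectangles; hence the two measures are equal, and Fubini's
    theorem factors the integral. *)
Lemma independent_integralM d1 d2 (U : measurableType d1) (V : measurableType d2)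
    (X : {RV P >-> U}) (Y : {RV P >-> V}) (g : U -> R) (h : V -> R) :
  independent P X Y ->
  measurable_fun setT g -> measurable_fun setT h ->
  square_integrable P setT (g \o X) -> square_integrable P setT (h \o Y) ->
  \int[P]_t (g (X t) * h (Y t)) = (\int[P]_t g (X t)) * (\int[P]_t h (Y t)).
Proof.
move=> XY mg mh iX iY.
have PT : (P setT < +oo)%E by rewrite probability_setT ltry.
have iX1 := square_integrable_integrable measurableT PT iX.
have iY1 := square_integrable_integrable measurableT PT iY.
have iXY := square_integrableM measurableT iX iY.
have mZ : measurable_fun setT (fun t => (X t, Y t)).
  by apply/measurable_fun_pair; exact: measurable_funP.
pose Zm := isMeasurableFun.Build _ _ _ _ _ mZ.
pose Z : {RV P >-> (U * V)%type} := HB.pack (fun t => (X t, Y t)) Zm.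
pose m1 := distribution P X; pose m2 := distribution P Y.
pose F (z : U * V) := (g z.1 * h z.2)%:E.
have mF : measurable_fun setT F.
  apply/measurable_EFinP/measurable_funM.
    exact: measurableT_comp mg measurable_fst.
  exact: measurableT_comp mh measurable_snd.
have mE : forall A : set (U * V), measurable A -> (m1 \x m2)%E A = distribution P Z A.
  by apply: product_measure_unique => A B mA mB; rewrite /= -XY.
have iF : (m1 \x m2)%E.-integrable setT F.
  have := integrable_pushforward (phi := Z) mZ mF iXY measurableT.
  move=> /integrableP[_ iZ]; apply/integrableP; split => //.
  by rewrite (eq_measure_integral (distribution P Z)) => [//|A mA _]; exact: mE.
have EZ : \int[P]_t (g (X t) * h (Y t)) = fine (\int[m1 \x m2]_z F z)%E.
  rewrite (eq_measure_integral (distribution P Z)) => [|A mA _]; last exact: mE.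
  by rewrite (integral_distribution (X := Z)).
have mgE : measurable_fun setT (EFin \o g) by exact/measurable_EFinP.
have mhE : measurable_fun setT (EFin \o h) by exact/measurable_EFinP.
have ig : m1.-integrable setT (EFin \o g).
  exact: (integrable_pushforward (phi := X) (measurable_funP X) mgE iX1 measurableT).
have ih : m2.-integrable setT (EFin \o h).
  exact: (integrable_pushforward (phi := Y) (measurable_funP Y) mhE iY1 measurableT).
have Eg : \int[m1]_u g u = \int[P]_t g (X t).
  by rewrite /Rintegral (integral_distribution (X := X) mgE).
have Eh : \int[m2]_u h u = \int[P]_t h (Y t).
  by rewrite /Rintegral (integral_distribution (X := Y) mhE).
rewrite EZ -(integral12_prod_meas1 iF) /fubini_F/= -Eg -Eh -RintegralZr//.
congr fine; apply: eq_integral => u _ /=.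
rewrite -RintegralZl// /Rintegral fineK//.
by apply: (integrable_fin_num measurableT); exact: (integrableZl measurableT (g u) ih).
Qed.

End Independence.

(** * Integrals over a countable law *)
Section PickleOrder.
Variable I : countType.

(** Exhausting sequence of finite sets, used to turn limits along the net of
    all finite sets into limits of sequences. *)
Definition pickle_lt (n : nat) : {fset I} := [fset i in pmap pickle_inv (iota 0 n)]%fset.

Lemma in_pickle_lt n i : (i \in pickle_lt n) = (choice.pickle i < n)%N.
Proof.
rewrite !inE/= mem_pmap; apply/mapP/idP => [[m]|ni].
  rewrite mem_iota add0n => /andP[_ mn] E.
  by have := @pickle_invK I m; rewrite -E /= => ->.
by exists (choice.pickle i); rewrite ?mem_iota ?add0n// pickleK_inv.
Qed.

Lemma pickle_lt_totally : pickle_lt @ \oo --> @summability.totally I.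
Proof.
move=> S [A _ AS]; exists (\max_(i <- A) (choice.pickle i).+1)%N => //= n /= An.
apply: AS => /=; apply/fsubsetP => i iA; rewrite in_pickle_lt.
exact: leq_trans (leq_bigmax_seq (F := fun i => (choice.pickle i).+1) i iA isT) An.
Qed.

End PickleOrder.

Section CountableLaw.
Context d (T : measurableType d) (R : realType) (P : probability T R).
Variables (I : countType) (v : T -> I) (rho : I -> R).
Hypothesis mv : forall A, measurable (v @^-1` A).
Hypothesis Pv : forall i, P (v @^-1` [set i]) = (rho i)%:E.

Lemma measurable_countable_comp d' (U : measurableType d') (g : I -> U) :
  measurable_fun setT (g \o v).
Proof. by move=> _ Y mY; rewrite setTI comp_preimage; exact: mv. Qed.


Let indic i := \1_(v @^-1` [set i]) : T -> R.

Lemma truncated_sum (g : I -> R) (A : {fset I}) t :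
  (if v t \in A then g (v t) else 0) = \sum_(i <- A) g i * indic i t.
Proof.
case: ifPn => vA; last first.
  rewrite big_seq big1// => i iA; rewrite /indic indicE memNset ?mulr0//=.
  by move=> vi; move: vA; rewrite vi iA.
rewrite (big_fsetD1 _ vA)/= /indic indicE mem_set// mulr1 big_seq big1 ?addr0// => i.
rewrite !inE => /andP[iv _]; rewrite indicE memNset ?mulr0//= => vi.
by rewrite vi eqxx in iv.
Qed.

Lemma integral_truncated (g : I -> R) (A : {fset I}) :
  (\int[P]_t (if v t \in A then g (v t) else 0)%:E = (\sum_(i <- A) g i * rho i)%:E)%E.
Proof.
under eq_integral do rewrite truncated_sum -sumEFin.
have ii i : P.-integrable setT (EFin \o indic i).
  exact: integrable_indic.
rewrite integral_sum//; last first.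
  by move=> i; apply: (integrableZl measurableT (g i) (ii i)).
rewrite -sumEFin; apply: eq_bigr => i _.
under eq_integral do rewrite EFinM.
rewrite (integralZl measurableT (ii i)) integral_indic// setIT EFinM.
by congr (_ * _)%E; exact: Pv.
Qed.

(** Monotone convergence along the exhausting sequence of finite sets. *)
Lemma ge0_integral_countable_law (g : I -> R) : (forall i, 0 <= g i) ->
  (\int[P]_t (g (v t))%:E <= \esum_(i in [set: I]) (g i * rho i)%:E)%E.
Proof.
move=> g0.
have rho0 i : 0 <= rho i by rewrite -lee_fin -Pv.
pose gn n t := (if v t \in pickle_lt I n then g (v t) else 0)%:E.
have gn0 n t : (0 <= gn n t)%E by rewrite /gn; case: ifP; rewrite lee_fin.
have mgn n : measurable_fun setT (gn n).
  exact: (measurable_countable_comp (fun i => (if i \in _ then g i else 0)%:E)).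
have ndgn t : nondecreasing_seq (gn^~ t).
  move=> m n mn; rewrite /gn !in_pickle_lt; case: ltnP => [vm|_].
    by rewrite (leq_trans vm mn).
  by case: ifP; rewrite lee_fin.
have lg t : gn^~ t @ \oo --> (g (v t))%:E.
  apply: cvg_near_cst; exists (choice.pickle (v t)).+1 => // n /= vn.
  by rewrite /gn in_pickle_lt vn.
have := @cvg_monotone_convergence _ _ _ P setT measurableT gn mgn
  (fun n t _ => gn0 n t) (fun t _ => ndgn t).
under eq_integral do rewrite (cvg_lim _ (lg _))//.
move=> /cvg_lim <- //; apply: lime_le.
  apply: ereal_nondecreasing_is_cvgn => m n mn; apply: ge0_le_integral => //.
  by move=> t _; exact: ndgn.
apply: nearW => n; rewrite integral_truncated; apply: esum_ge.
exists [set` pickle_lt I n] => //; rewrite fsbig_finite//= set_fsetK sumEFin.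
exact: lexx.
Qed.

(** Dominated convergence along the exhausting sequence. The expectation is
    identified with the limit of the unordered partial sums, which is the form
    in which the Fourier expansion is given. *)
Lemma Rintegral_countable_law (g : I -> R) (m : R) :
  P.-integrable setT (EFin \o (fun t => g (v t))) ->
  (fun A : {fset I} => \sum_(i <- A) g i * rho i) @ summability.totally --> m ->
  \int[P]_t g (v t) = m.
Proof.
move=> ig gm.
pose gn n t := (if v t \in pickle_lt I n then g (v t) else 0)%:E.
have mgn n : measurable_fun setT (gn n).
  exact: (measurable_countable_comp (fun i => (if i \in _ then g i else 0)%:E)).
have lg t : gn^~ t @ \oo --> (g (v t))%:E.
  apply: cvg_near_cst; exists (choice.pickle (v t)).+1 => // n /= vn.
  by rewrite /gn in_pickle_lt vn.
have mg : measurable_fun setT (fun t => (g (v t))%:E).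
  exact: (measurable_countable_comp (EFin \o g)).
have [||_ _ /=] := @dominated_convergence _ _ _ P setT measurableT gn _
    (abse \o (EFin \o (fun t => g (v t)))) mgn mg _ (integrable_abse ig) _.
- by apply: aeW => t _; exact: lg.
- by apply: aeW => t n _ /=; rewrite /gn; case: ifP => _; rewrite /= ?normr0 lee_fin ?normr_ge0.
under eq_fun do rewrite integral_truncated.
move=> h; have h' := cvg_comp _ _ (@pickle_lt_totally I) gm.
have h2 : (\sum_(i <- pickle_lt I n) g i * rho i)%:E @[n --> \oo] --> m%:E.
  by apply: cvg_EFin; [exact: nearW|exact: h'].
by rewrite /Rintegral -(cvg_unique _ h2 h).
Qed.

End CountableLaw.

(** * Averages of independent samples *)
Section IidSample.
Context d (T : measurableType d) (R : realType) (P : probability T R).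

Let PT : (P setT < +oo)%E. Proof. by rewrite probability_setT ltry. Qed.

Lemma Rintegral_cstP (r : R) : \int[P]_t r = r.
Proof.
rewrite Rintegral_cst// [X in fine X](_ : _ = 1%E) ?mulr1//.
exact: probability_setT.
Qed.

Lemma Rintegral_sum (I : eqType) (r : seq I) (F : I -> T -> R) :
  (forall i, P.-integrable setT (EFin \o F i)) ->
  \int[P]_t (\sum_(i <- r) F i t) = \sum_(i <- r) \int[P]_t F i t.
Proof.
move=> iF; rewrite /Rintegral.
under eq_integral do rewrite -sumEFin.
rewrite integral_sum// sum_fine// => i _.
exact: (integrable_fin_num measurableT (iF i)).
Qed.

(** Only the diagonal terms of the double sum of covariances survive. *)
Lemma mean_square_average (K : nat) (Z : 'I_K -> T -> R) (m : R) :
  (0 < K)%N -> (forall k, square_integrable P setT (Z k)) ->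
  (forall k, \int[P]_t Z k t = m) ->
  (forall k l, k != l ->
     \int[P]_t (Z k t * Z l t) = \int[P]_t Z k t * (\int[P]_t Z l t)) ->
  \int[P]_t (K%:R^-1 * (\sum_k Z k t) - m) ^+ 2
  = K%:R^-1 ^+ 2 * \sum_k (\int[P]_t (Z k t ^+ 2) - m ^+ 2).
Proof.
move=> K0 iZ EZ ZZ.
have K0' : K%:R != 0 :> R by rewrite pnatr_eq0 -lt0n.
have sm := square_integrable_cst measurableT PT m.
have im := square_integrable_integrable measurableT PT sm.
pose Y k t := Z k t - m.
have iY k : square_integrable P setT (Y k) by exact: square_integrableB.
have iYY k l := square_integrableM measurableT (iY k) (iY l).
have iZ1 k := square_integrable_integrable measurableT PT (iZ k).
have iZZ k l := square_integrableM measurableT (iZ k) (iZ l).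
have imZ k : P.-integrable setT (EFin \o (fun t => m * Z k t)).
  exact: (square_integrableM measurableT sm (iZ k)).
have EYY k l : \int[P]_t (Y k t * Y l t) = \int[P]_t (Z k t * Z l t) - m ^+ 2.
  have -> : \int[P]_t (Y k t * Y l t) =
    \int[P]_t ((Z k t * Z l t - (m * Z k t + m * Z l t)) + m * m).
    by apply: eq_Rintegral => t _; rewrite /Y; ring.
  have imm : P.-integrable setT (EFin \o (fun=> m * m)).
    exact: (square_integrableM measurableT sm sm).
  have i2 := integrableD measurableT (imZ k) (imZ l).
  have i3 := integrableB measurableT (iZZ k l) i2.
  rewrite RintegralD// RintegralB// RintegralD// !RintegralZl// !EZ Rintegral_cstP.
  by ring.
transitivity (\int[P]_t (K%:R^-1 ^+ 2 * \sum_k \sum_l Y k t * Y l t)).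
  apply: eq_Rintegral => t _.
  have -> : \sum_k \sum_l Y k t * Y l t = (\sum_k Y k t) ^+ 2.
    by rewrite expr2 mulr_suml; apply: eq_bigr => k _; rewrite mulr_sumr.
  rewrite -exprMn; congr (_ ^+ 2); rewrite big_split/= mulrDr; congr (_ + _).
  by rewrite sumr_const card_ord -[X in _ = _ * X]mulr_natl mulrA mulVf// mul1r.
have iS k : P.-integrable setT (EFin \o (fun t => \sum_l Y k t * Y l t)).
  have -> : EFin \o (fun t => \sum_l Y k t * Y l t) =
      (fun t => \sum_l (Y k t * Y l t)%:E)%E.
    by apply/funext => t; rewrite /= sumEFin.
  by apply: integrable_sum => // l _; exact: iYY.
rewrite RintegralZl//; last first.
  have -> : EFin \o (fun t => \sum_k \sum_l Y k t * Y l t) =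
      (fun t => \sum_k (\sum_l Y k t * Y l t)%:E)%E.
    by apply/funext => t; rewrite /= sumEFin.
  by apply: integrable_sum => // k _; exact: iS.
congr (_ * _); rewrite Rintegral_sum//; apply: eq_bigr => k _.
rewrite Rintegral_sum// (bigD1 k)//= EYY big1 ?addr0 => [|l lk].
  by congr (_ - _).
by rewrite EYY ZZ 1?eq_sym// !EZ expr2 subrr.
Qed.

Variables (K : nat) (rho : int * int -> R) (w : 'I_K -> T -> int * int).
Hypothesis iidw : iid P rho w.

(** The product rule is applied to the family of sets that is full except at
    the two indices k and l. *)
Lemma iid_uncorrelated (g h : int * int -> R) (k l : 'I_K) : k != l ->
  square_integrable P setT (g \o w k) -> square_integrable P setT (h \o w l) ->
  \int[P]_t (g (w k t) * h (w l t)) =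
  (\int[P]_t g (w k t)) * (\int[P]_t h (w l t)).
Proof.
move=> kl ig ih; have [mw _ Pw] := iidw.
have mg : measurable_fun setT (g \o w k) by case: ig.
have mh : measurable_fun setT (h \o w l) by case: ih.
pose Xm := isMeasurableFun.Build _ _ _ _ _ mg.
pose X : {RV P >-> R} := HB.pack (g \o w k) Xm.
pose Ym := isMeasurableFun.Build _ _ _ _ _ mh.
pose Y : {RV P >-> R} := HB.pack (h \o w l) Ym.
apply: (@independent_integralM _ _ _ P _ _ _ _ X Y id id) => // A B mA mB.
pose S j := if j == k then g @^-1` A else if j == l then h @^-1` B else setT.
have := Pw S; rewrite (bigD1 k)//= (bigD1 l) 1?eq_sym//= {2 3}/S eqxx.
rewrite eq_sym (negbTE kl) eqxx big1 ?mule1 => [|j /andP[jk jl]]; last first.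
  by rewrite /S (negbTE jk) (negbTE jl) preimage_setT probability_setT.
move=> <-; congr (P _); apply/seteqP; split=> t.
  move=> [At Bt] j _; rewrite /S/=.
  by case: eqP => [->//|_]; case: eqP => [->|].
move=> h'; split; first by have := h' k I; rewrite /S/= eqxx.
by have := h' l I; rewrite /S/= eq_sym (negbTE kl) eqxx.
Qed.

End IidSample.

(** * Inequalities for weighted sums over the frequencies *)
Section WeightedSums.
Variable R : realType.
Implicit Types rho g h y : int * int -> R.

(** Each finite partial sum is bounded separately. All the convexity
    inequalities below are pointwise bounds of this shape. *)
Lemma Erho_le rho g g1 g2 (a b G1 G2 : R) :
  (forall w, 0 <= rho w) -> 0 <= a -> 0 <= b ->
  (forall w, g w <= a * g1 w + b * g2 w) ->
  (Erho rho g1 <= G1%:E)%E -> (Erho rho g2 <= G2%:E)%E ->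
  (Erho rho g <= (a * G1 + b * G2)%:E)%E.
Proof.
move=> rho0 a0 b0 gle h1 h2; apply: ge_ereal_sup => _ [X [finX _] <-].
rewrite fsbig_finite//= sumEFin lee_fin.
have sub h H : (Erho rho h <= H%:E)%E -> \sum_(i <- fset_set X) h i * rho i <= H.
  move=> hH; rewrite -lee_fin; apply: le_trans hH; apply: esum_ge.
  by exists X; [split|rewrite fsbig_finite//= sumEFin].
apply: (@le_trans _ _ (a * (\sum_(i <- fset_set X) g1 i * rho i)
                      + b * (\sum_(i <- fset_set X) g2 i * rho i))).
  rewrite !mulr_sumr -big_split/=; apply: ler_sum => w _.
  by rewrite !mulrA -mulrDl ler_wpM2r.
by apply: lerD; apply: ler_wpM2l => //; exact: sub.
Qed.

(** Integrate the weighted arithmetic-geometric inequality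
    2 V B y^2 h <= B^2 y^4 + V^2 h^2. *)
Lemma Erho_cauchy_schwarz rho y h (V B : R) :
  (forall w, 0 <= rho w) -> 0 < V -> 0 < B ->
  (Erho rho (fun w => (y w ^+ 4)%R) <= (V ^+ 2)%:E)%E ->
  (Erho rho (fun w => (h w ^+ 2)%R) <= (B ^+ 2)%:E)%E ->
  (Erho rho (fun w => (y w ^+ 2 * h w)%R) <= (V * B)%:E)%E.
Proof.
move=> rho0 V0 B0 hV hB.
have -> : V * B = (B / (2 * V)) * V ^+ 2 + (V / (2 * B)) * B ^+ 2.
  by field; rewrite !gt_eqF.
apply: (Erho_le rho0 _ _ _ hV hB).
- by rewrite divr_ge0// ?mulr_ge0// ltW.
- by rewrite divr_ge0// ?mulr_ge0// ltW.
move=> w; rewrite -subr_ge0.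
rewrite (_ : _ - _ = (B * y w ^+ 2 - V * h w) ^+ 2 / (2 * V * B)); last first.
  by field; rewrite !gt_eqF.
by rewrite divr_ge0 ?sqr_ge0// ?mulr_ge0// ltW.
Qed.

(** Jensen's inequality for the fourth power, through the tangent line at the
    mean: y^4 >= 4 S^3 y - 3 S^4, that is
    (y - S)^2 ((y + S)^2 + 2 S^2) >= 0. *)
Lemma Erho_fourth_power_ge rho y (S : R) : (forall w, 0 <= rho w) ->
  (Erho rho (fun=> 1%R) <= 1)%E -> (forall w, 0 <= y w) -> 0 < S ->
  (Erho rho y = S%:E)%E -> ((S ^+ 4)%:E <= Erho rho (fun w => (y w ^+ 4)%R))%E.
Proof.
move=> rho0 rho1 y0 S0 yS.
have : (0 <= Erho rho (fun w => (y w ^+ 4)%R))%E.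
  by apply: esum_ge0 => w _; rewrite lee_fin mulr_ge0// exprn_ge0.
case E : (Erho _ _) => [V| |]// _; last by rewrite leey.
have hV : (Erho rho (fun w => (y w ^+ 4)%R) <= V%:E)%E by rewrite E.
have S30 : 0 < 4 * S ^+ 3 by rewrite mulr_gt0// exprn_gt0.
have : (Erho rho y <= ((4 * S ^+ 3)^-1 * V + (3 * S / 4) * 1)%:E)%E.
  apply: (Erho_le rho0 _ _ _ hV rho1); rewrite ?invr_ge0 ?ltW//.
    by rewrite divr_gt0// mulr_gt0.
  move=> w; rewrite mulr1 -subr_ge0.
  rewrite (_ : _ - _ = (y w - S) ^+ 2 * ((y w + S) ^+ 2 + 2 * S ^+ 2) / (4 * S ^+ 3)).
    apply: divr_ge0; last exact: ltW.
    by rewrite mulr_ge0 ?sqr_ge0// addr_ge0 ?sqr_ge0// mulr_ge0// sqr_ge0.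
  by field; rewrite gt_eqF.
rewrite yS !lee_fin mulr1 => h.
have := ler_wpM2r (ltW S30) h; rewrite (mulrDl _ (3 * S / 4)).
have -> : (4 * S ^+ 3)^-1 * V * (4 * S ^+ 3) = V.
  by field; rewrite gt_eqF.
lra.
Qed.

Lemma cnorm_ge0 (v : R[i] * R[i]) : 0 <= cnorm v.
Proof. exact: sqrtr_ge0. Qed.

Lemma admissible_sum1 d (C : R) rho : admissible d C rho ->
  Erho rho (fun=> 1%R) = 1%E.
Proof.
by move=> [_ <- _]; apply: eq_esum => w _; rewrite mul1r.
Qed.

Section FourierLaw.
Variables (d : nat) (C : R) (fhat : int * int -> R[i] * R[i]).
Hypothesis Hadm : admissible d C (fourier_law fhat).

(** Were the total mass zero or infinite, the Fourier law would vanish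
    identically, contradicting the positivity of an admissible law. *)
Lemma fourier_law_mass : exists S : R,
  [/\ 0 < S, (\esum_(w in [set: int * int]) (cnorm (fhat w))%:E = S%:E)%E &
      forall w, 0 < cnorm (fhat w)].
Proof.
have [pos _ _] := Hadm; rewrite /fourier_law in pos.
case E : esum pos => [S| |]/= pos; last 2 first.
- by have := pos (0, 0); rewrite invr0 mulr0 ltxx.
- by have := pos (0, 0); rewrite invr0 mulr0 ltxx.
have S0 : 0 <= S.
  by rewrite -lee_fin -E; apply: esum_ge0 => w _; rewrite lee_fin cnorm_ge0.
have S0' : 0 < S.
  rewrite lt_neqAle S0 andbT eq_sym; apply/eqP => S00.
  by have := pos (0, 0); rewrite S00 invr0 mulr0 ltxx.
by exists S; split => // w; have := pos w; rewrite pmulr_lgt0 ?invr_gt0.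
Qed.

(** Under any rho the ratio |fhat| / rho has mean S, and under the Fourier law
    it is constantly S. *)
Lemma Erho_fourth_power_min rho : admissible d C rho ->
  (Erho (fourier_law fhat) (fun w => (cnorm (fhat w) ^+ 4 / fourier_law fhat w ^+ 4)%R)
   <= Erho rho (fun w => (cnorm (fhat w) ^+ 4 / rho w ^+ 4)%R))%E.
Proof.
move=> Hrho; have [S [S0 SE cpos]] := fourier_law_mass.
have -> : Erho (fourier_law fhat)
    (fun w => cnorm (fhat w) ^+ 4 / fourier_law fhat w ^+ 4) = (S ^+ 4)%:E.
  have [_ law1 _] := Hadm.
  apply: le_anti; apply/andP; split.
    rewrite -[S ^+ 4]mulr1 -[X in X%:E]addr0 -(mul0r 1).
    apply: (@Erho_le _ _ (fun=> 1) (fun=> 1)) => //; rewrite ?(admissible_sum1 Hadm)//.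
    - by move=> w; have [+ _ _] := Hadm => /(_ w)/ltW.
    - by rewrite exprn_ge0// ltW.
    - move=> w; rewrite /fourier_law SE/= mul0r addr0 mulr1 expr_div_n invf_div.
      by rewrite mulrC divfK// expf_neq0// gt_eqF.
  rewrite (_ : (fun w => _) = (fun w => (cnorm (fhat w) / fourier_law fhat w) ^+ 4)).
    apply: Erho_fourth_power_ge => //.
    - by move=> w; have [+ _ _] := Hadm => /(_ w)/ltW.
    - by rewrite (admissible_sum1 Hadm).
    - move=> w; rewrite divr_ge0 ?cnorm_ge0//.
      by have [+ _ _] := Hadm => /(_ w)/ltW.
    - rewrite -SE; apply: eq_esum => w _; rewrite divfK//.
      by have [+ _ _] := Hadm => /(_ w)/gt_eqF ->.
  by apply/funext => w; rewrite [RHS]expr_div_n.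
have [rpos _ _] := Hrho.
rewrite (_ : (fun w => cnorm (fhat w) ^+ 4 / _) = (fun w => (cnorm (fhat w) / rho w) ^+ 4)).
  apply: Erho_fourth_power_ge => //.
  - by move=> w; rewrite ltW.
  - by rewrite (admissible_sum1 Hrho).
  - by move=> w; rewrite divr_ge0 ?cnorm_ge0// ltW.
  - by rewrite -SE; apply: eq_esum => w _; rewrite divfK// gt_eqF.
by apply/funext => w; rewrite expr_div_n.
Qed.

End FourierLaw.

End WeightedSums.

(** * Waves and constant coefficient differential operators *)

Local Open Scope complex_scope.

Section ComplexWaves.
Variable R : realType.
Local Notation C := R[i].
Implicit Types (z a b : C) (w : int * int) (x : R * R).

Definition normsq z : R := complex.Re z ^+ 2 + complex.Im z ^+ 2.

Lemma normsq_ge0 z : 0 <= normsq z.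
Proof. by rewrite addr_ge0 ?sqr_ge0. Qed.

Lemma normsqM z a : normsq (z * a) = normsq z * normsq a.
Proof. by case: z => p q; case: a => r s; rewrite /normsq/=; ring. Qed.

Lemma normsqX z n : normsq (z ^+ n) = normsq z ^+ n.
Proof.
elim: n => [|n IHn]; first by rewrite !expr0 /normsq/=; ring.
by rewrite !exprS normsqM IHn.
Qed.

Lemma normsqD z a : normsq (z + a) <= 2 * (normsq z + normsq a).
Proof.
case: z => p q; case: a => r s; rewrite /normsq/=.
have := sqr_ge0 (p - r); have := sqr_ge0 (q - s); lra.
Qed.

Lemma Re_conjM z : complex.Re (z^* * z) = normsq z.
Proof. by case: z => p q; rewrite /normsq/=; ring. Qed.

Lemma ReD z a : complex.Re (z + a) = complex.Re z + complex.Re a.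
Proof. by case: z; case: a. Qed.

Lemma ImD z a : complex.Im (z + a) = complex.Im z + complex.Im a.
Proof. by case: z; case: a. Qed.

Lemma Re_sum (I : Type) (r : seq I) (F : I -> C) :
  complex.Re (\sum_(i <- r) F i) = \sum_(i <- r) complex.Re (F i).
Proof. exact: (big_morph _ ReD). Qed.

Lemma Im_sum (I : Type) (r : seq I) (F : I -> C) :
  complex.Im (\sum_(i <- r) F i) = \sum_(i <- r) complex.Im (F i).
Proof. exact: (big_morph _ ImD). Qed.

(** Lagrange's identity: twice the difference of the two sides is the sum over
    i and j of (F i - F j)^2. *)
Lemma sqr_sum_le (I : finType) (F : I -> R) :
  (\sum_i F i) ^+ 2 <= #|I|%:R * \sum_i F i ^+ 2.
Proof.
have : 0 <= \sum_i \sum_j (F i - F j) ^+ 2.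
  by apply: sumr_ge0 => i _; apply: sumr_ge0 => j _; exact: sqr_ge0.
have -> : \sum_i \sum_j (F i - F j) ^+ 2 =
    2 * (#|I|%:R * \sum_i F i ^+ 2) - 2 * (\sum_i F i) ^+ 2.
  transitivity (\sum_i (#|I|%:R * F i ^+ 2 + \sum_j F j ^+ 2
                        - 2 * (F i * \sum_j F j))).
    apply: eq_bigr => i _.
    have -> : #|I|%:R * F i ^+ 2 = \sum_(j : I) F i ^+ 2.
      by rewrite sumr_const mulr_natl.
    rewrite !mulr_sumr -big_split -sumrB/=.
    by apply: eq_bigr => j _; ring.
  rewrite sumrB big_split/= -mulr_sumr sumr_const -mulr_sumr -mulr_suml.
  by rewrite -mulr_natl; ring.
lra.
Qed.

Lemma normsq_sum (I : finType) (F : I -> C) :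
  normsq (\sum_i F i) <= #|I|%:R * \sum_i normsq (F i).
Proof.
rewrite /normsq Re_sum Im_sum big_split/= mulrDr.
by apply: lerD; exact: sqr_sum_le.
Qed.

Lemma cnorm_sqr (v : C * C) : cnorm v ^+ 2 = normsq v.1 + normsq v.2.
Proof. by rewrite sqr_sqrtr// addr_ge0// addr_ge0 ?sqr_ge0. Qed.

Definition phase w x : R := w.1%:~R * x.1 + w.2%:~R * x.2.

Lemma phaseC w x : phase w x = w.2%:~R * x.2 + w.1%:~R * x.1.
Proof. exact: addrC. Qed.

Lemma Re_wave z w x : complex.Re (z * wave w x) =
  complex.Re z * cos (phase w x) - complex.Im z * sin (phase w x).
Proof. by case: z. Qed.

Lemma Im_wave z w x : complex.Im (z * wave w x) =
  complex.Re z * sin (phase w x) + complex.Im z * cos (phase w x).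
Proof. by case: z => p q. Qed.

Lemma normsq_wave w x : normsq (wave w x) = 1.
Proof. by rewrite /normsq/= cos2Dsin2. Qed.

Lemma measurable_phase w : measurable_fun setT (phase w).
Proof. by apply: measurable_funD; apply: measurable_funM. Qed.

Lemma measurable_sin_phase w : measurable_fun setT (fun x => sin (phase w x)).
Proof.
apply: measurableT_comp; last exact: measurable_phase.
by apply: continuous_measurable_fun; exact: continuous_sin.
Qed.

Lemma measurable_cos_phase w : measurable_fun setT (fun x => cos (phase w x)).
Proof.
apply: measurableT_comp; last exact: measurable_phase.
by apply: continuous_measurable_fun; exact: continuous_cos.
Qed.

Lemma measurable_Re_wave z w :
  measurable_fun setT (fun x => complex.Re (z * wave w x)).
Proof.
under eq_fun do rewrite Re_wave.
by apply: measurable_funB; apply: measurable_funM => //;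
  [exact: measurable_cos_phase|exact: measurable_sin_phase].
Qed.

Lemma measurable_Im_wave z w :
  measurable_fun setT (fun x => complex.Im (z * wave w x)).
Proof.
under eq_fun do rewrite Im_wave.
by apply: measurable_funD; apply: measurable_funM => //;
  [exact: measurable_sin_phase|exact: measurable_cos_phase].
Qed.

End ComplexWaves.

Section Derivatives.
Variable R : realType.
Local Notation C := R[i].

(** Real form shared by both parts of a trigonometric polynomial restricted to
    a coordinate line. *)
Lemma derive1_wave_sum (K : nat) (p q al be : 'I_K -> R) (t : R) :
  derive1 (fun s => \sum_k (p k * cos (al k * s + be k) + q k * sin (al k * s + be k))) t
  = \sum_k (- (al k * p k) * sin (al k * t + be k) + al k * q k * cos (al k * t + be k)).
Proof.
have D k : is_derive t 1
    (fun s => p k * cos (al k * s + be k) + q k * sin (al k * s + be k))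
    (- (al k * p k) * sin (al k * t + be k) + al k * q k * cos (al k * t + be k)).
  have Dl : is_derive t 1 (fun s => al k * s + be k) (al k).
    by apply: is_derive_eq; rewrite /GRing.scale/=; ring.
  have Dc := is_derive1_comp (f := cos) (is_derive_cos _) Dl.
  have Ds := is_derive1_comp (f := sin) (is_derive_sin _) Dl.
  have := is_deriveD (is_deriveZ (p k) Dc) (is_deriveZ (q k) Ds).
  by move=> /is_derive_eq; apply; rewrite /GRing.scale/=; ring.
rewrite derive1E.
have -> : (fun s => \sum_k (p k * cos (al k * s + be k) + q k * sin (al k * s + be k)))
  = \sum_k (fun s => p k * cos (al k * s + be k) + q k * sin (al k * s + be k)).
  by apply/funext => s; rewrite fct_sumE.
exact: (@derive_val _ _ _ _ _ _ _ (is_derive_sum D)).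
Qed.

Section PartialDerivatives.
Variables (K : nat) (w : 'I_K -> int * int).

Let trig (a : 'I_K -> C) := fun x : R * R => \sum_k a k * wave (w k) x.

Lemma pd1_trig a : pd1 (trig a) = trig (fun k => (0 +i* (w k).1%:~R) * a k).
Proof.
apply/funext => x; rewrite /pd1 /trig.
have Rf s : complex.Re (\sum_k a k * wave (w k) (s, x.2)) =
    \sum_k (complex.Re (a k) * cos ((w k).1%:~R * s + (w k).2%:~R * x.2)
    + - complex.Im (a k) * sin ((w k).1%:~R * s + (w k).2%:~R * x.2)).
  by rewrite Re_sum; apply: eq_bigr => k _; rewrite Re_wave mulNr.
have If s : complex.Im (\sum_k a k * wave (w k) (s, x.2)) =
    \sum_k (complex.Im (a k) * cos ((w k).1%:~R * s + (w k).2%:~R * x.2)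
    + complex.Re (a k) * sin ((w k).1%:~R * s + (w k).2%:~R * x.2)).
  by rewrite Im_sum; apply: eq_bigr => k _; rewrite Im_wave addrC.
under eq_fun do rewrite Rf; under [X in _ +i* derive1 X _]eq_fun do rewrite If.
rewrite !derive1_wave_sum; apply/eqP; rewrite eq_complex; apply/andP; split.
  rewrite Re_sum/=; apply/eqP/eq_bigr => k _; rewrite Re_wave.
  by case: (a k) => r s /=; rewrite /phase; ring.
rewrite Im_sum/=; apply/eqP/eq_bigr => k _; rewrite Im_wave.
by case: (a k) => r s /=; rewrite /phase; ring.
Qed.

Lemma pd2_trig a : pd2 (trig a) = trig (fun k => (0 +i* (w k).2%:~R) * a k).
Proof.
apply/funext => x; rewrite /pd2 /trig.
have Rf s : complex.Re (\sum_k a k * wave (w k) (x.1, s)) =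
    \sum_k (complex.Re (a k) * cos ((w k).2%:~R * s + (w k).1%:~R * x.1)
    + - complex.Im (a k) * sin ((w k).2%:~R * s + (w k).1%:~R * x.1)).
  by rewrite Re_sum; apply: eq_bigr => k _; rewrite Re_wave mulNr phaseC.
have If s : complex.Im (\sum_k a k * wave (w k) (x.1, s)) =
    \sum_k (complex.Im (a k) * cos ((w k).2%:~R * s + (w k).1%:~R * x.1)
    + complex.Re (a k) * sin ((w k).2%:~R * s + (w k).1%:~R * x.1)).
  by rewrite Im_sum; apply: eq_bigr => k _; rewrite Im_wave addrC phaseC.
under eq_fun do rewrite Rf; under [X in _ +i* derive1 X _]eq_fun do rewrite If.
rewrite !derive1_wave_sum; apply/eqP; rewrite eq_complex; apply/andP; split.
  rewrite Re_sum/=; apply/eqP/eq_bigr => k _; rewrite Re_wave phaseC.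
  by case: (a k) => r s /=; ring.
rewrite Im_sum/=; apply/eqP/eq_bigr => k _; rewrite Im_wave phaseC.
by case: (a k) => r s /=; ring.
Qed.

Lemma iter_pd1_trig n a :
  iter n (@pd1 R) (trig a) = trig (fun k => (0 +i* (w k).1%:~R) ^+ n * a k).
Proof.
elim: n => [|n IHn] /=.
  by congr trig; apply/funext => k; rewrite expr0 mul1r.
by rewrite IHn pd1_trig; congr trig; apply/funext => k; rewrite exprS mulrA.
Qed.

Lemma iter_pd2_trig n a :
  iter n (@pd2 R) (trig a) = trig (fun k => (0 +i* (w k).2%:~R) ^+ n * a k).
Proof.
elim: n => [|n IHn] /=.
  by congr trig; apply/funext => k; rewrite expr0 mul1r.
by rewrite IHn pd2_trig; congr trig; apply/funext => k; rewrite exprS mulrA.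
Qed.

Variables (M : nat) (alpha : 'I_M -> nat * nat) (c : 'I_M -> C * C).

(** The scalar multiplier by which the operator with coefficients e acts on the
    wave of frequency v. *)
Definition symbol (e : 'I_M -> C) (v : int * int) : C :=
  \sum_m (0 +i* v.1%:~R) ^+ (alpha m).1 * (0 +i* v.2%:~R) ^+ (alpha m).2 * e m.

Definition diff_coef (v : int * int) (b : C * C) : C :=
  symbol (fun m => (c m).1) v * b.1 + symbol (fun m => (c m).2) v * b.2.

(** Waves are eigenfunctions of the partial derivatives. *)
Lemma diff_op_model (b : 'I_K -> C * C) :
  diff_op alpha c (model w b) = trig (fun k => diff_coef (w k) (b k)).
Proof.
apply/funext => x; rewrite /diff_op /model/=.
have E m : (fun y => (c m).1 * (\sum_k (b k).1 * wave (w k) y) +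
    (c m).2 * (\sum_k (b k).2 * wave (w k) y)) =
    trig (fun k => (c m).1 * (b k).1 + (c m).2 * (b k).2).
  apply/funext => y; rewrite /trig !mulr_sumr -big_split/=.
  by apply: eq_bigr => k _; rewrite mulrDl !mulrA.
under eq_bigr do rewrite E iter_pd2_trig iter_pd1_trig.
rewrite /trig exchange_big/=; apply: eq_bigr => k _.
rewrite /diff_coef /symbol !mulr_suml -big_split/= mulr_suml.
by apply: eq_bigr => m _; rewrite !mulrDr !mulrA.
Qed.

End PartialDerivatives.

End Derivatives.

Section SymbolBound.
Variable R : realType.
Local Notation C := R[i].
Variables (M : nat) (alpha : 'I_M -> nat * nat) (c : 'I_M -> C * C) (d : nat).
Hypothesis Halpha : forall m, ((alpha m).1 + (alpha m).2 <= d)%N.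

(** A common bound for all squared monomials of degree at most d in the
    frequency; its mean square only involves moments of
    order 4 d. *)
Definition growth (v : int * int) : R :=
  1 + (`|v.1%:~R| ^+ (2 * d) + `|v.2%:~R| ^+ (2 * d)).

Lemma monomial_le_growth (v : int * int) (m : 'I_M) :
  (v.1%:~R ^+ 2) ^+ (alpha m).1 * (v.2%:~R ^+ 2) ^+ (alpha m).2 <= growth v.
Proof.
rewrite -(real_normK (num_real v.1%:~R)) -(real_normK (num_real v.2%:~R)).
rewrite -!exprM /growth.
move: (normr_ge0 (v.1%:~R : R)) (normr_ge0 (v.2%:~R : R)).
move: `|v.1%:~R| `|v.2%:~R| => p q p0 q0.
pose n := Num.max p q.
have n0 : 0 <= n by rewrite le_max p0.
apply: (@le_trans _ _ (n ^+ (2 * ((alpha m).1 + (alpha m).2)))).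
  rewrite mulnDr exprD; apply: ler_pM; rewrite ?exprn_ge0//.
    by apply: lerXn2r; rewrite ?nnegrE// le_max lexx.
  by apply: lerXn2r; rewrite ?nnegrE// le_max lexx orbT.
have P0 := exprn_ge0 (2 * d) p0; have Q0 := exprn_ge0 (2 * d) q0.
have [n1|/ltW n1] := leP n 1.
  by apply: (@le_trans _ _ 1); [exact: exprn_ile1|lra].
apply: (@le_trans _ _ (n ^+ (2 * d))).
  by apply: ler_weXn2l => //; rewrite leq_mul2l Halpha.
by rewrite /n maxEle; case: ifP => _; lra.
Qed.

Definition symbol_cst : R := 2 * (M%:R * \sum_m cnorm (c m) ^+ 2).

Lemma symbol_cst_ge0 : 0 <= symbol_cst.
Proof.
by rewrite mulr_ge0// mulr_ge0// sumr_ge0// => m _; rewrite sqr_ge0.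
Qed.

Lemma normsq_symbol_le (e : 'I_M -> C) v :
  normsq (symbol alpha e v) <= M%:R * (growth v * \sum_m normsq (e m)).
Proof.
apply: (le_trans (normsq_sum _)); rewrite card_ord ler_wpM2l//.
rewrite mulr_sumr; apply: ler_sum => m _.
rewrite !normsqM !normsqX ler_wpM2r ?normsq_ge0//.
by rewrite {1 2}/normsq/= expr0n/= !add0r monomial_le_growth.
Qed.

Lemma normsq_diff_coef_le v b :
  normsq (diff_coef alpha c v b) <= symbol_cst * growth v * cnorm b ^+ 2.
Proof.
apply: (le_trans (normsqD _ _)); rewrite !normsqM.
have h1 := normsq_symbol_le (fun m => (c m).1) v.
have h2 := normsq_symbol_le (fun m => (c m).2) v.
have b1 := normsq_ge0 b.1; have b2 := normsq_ge0 b.2.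
rewrite cnorm_sqr /symbol_cst; under eq_bigr do rewrite cnorm_sqr.
rewrite big_split/=.
have g0 : 0 <= growth v by rewrite addr_ge0// addr_ge0// exprn_ge0.
have s1 : 0 <= \sum_m normsq (c m).1 by apply: sumr_ge0 => m _; exact: normsq_ge0.
have s2 : 0 <= \sum_m normsq (c m).2 by apply: sumr_ge0 => m _; exact: normsq_ge0.
have k1 := ler_wpM2r b1 h1; have k2 := ler_wpM2r b2 h2.
have mg : 0 <= M%:R * growth v by rewrite mulr_ge0.
have e1 := mulr_ge0 (mulr_ge0 mg s1) b2.
have e2 := mulr_ge0 (mulr_ge0 mg s2) b1.
lra.
Qed.

End SymbolBound.

(** * Norms of trigonometric polynomials *)
Section TrigonometricIntegrals.
Variable R : realType.
Local Notation C := R[i].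
Context d (T : measurableType d) (mu : {measure set T -> \bar R}) (D : set T).
Hypothesis mD : measurable D.
Hypothesis muD : (mu D < +oo)%E.
Variable X : T -> R * R.
Hypothesis mX : measurable_fun D X.

Lemma norm_sin_le1 (t : R) : `|sin t| <= 1.
Proof. by rewrite ler_norml sin_geN1 sin_le1. Qed.

Lemma norm_cos_le1 (t : R) : `|cos t| <= 1.
Proof. by rewrite ler_norml cos_geN1 cos_le1. Qed.

Lemma square_integrable_Re_trig (K : nat) (w : 'I_K -> int * int) (a : 'I_K -> C) :
  square_integrable mu D (fun t => complex.Re (\sum_k a k * wave (w k) (X t))).
Proof.
under eq_fun do rewrite Re_sum; apply: square_integrable_sum => // k.
apply: (bounded_square_integrable mD muD
         (M := `|complex.Re (a k)| + `|complex.Im (a k)|)).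
  exact: measurableT_comp (measurable_Re_wave _ _) mX.
move=> t _; rewrite Re_wave (le_trans (ler_normB _ _))// !normrM.
by apply: lerD; rewrite ler_piMr ?norm_sin_le1 ?norm_cos_le1.
Qed.

Lemma square_integrable_Im_trig (K : nat) (w : 'I_K -> int * int) (a : 'I_K -> C) :
  square_integrable mu D (fun t => complex.Im (\sum_k a k * wave (w k) (X t))).
Proof.
under eq_fun do rewrite Im_sum; apply: square_integrable_sum => // k.
apply: (bounded_square_integrable mD muD
         (M := `|complex.Re (a k)| + `|complex.Im (a k)|)).
  exact: measurableT_comp (measurable_Im_wave _ _) mX.
move=> t _; rewrite Im_wave (le_trans (ler_normD _ _))// !normrM.
by apply: lerD; rewrite ler_piMr ?norm_sin_le1 ?norm_cos_le1.
Qed.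

End TrigonometricIntegrals.

Section Square.
Variable R : realType.
Local Notation C := R[i].
Local Notation leb2 := (@lebesgue_measure R \x @lebesgue_measure R)%E.

Let RR := (measurableTypeR R * measurableTypeR R)%type.

Lemma measurable_square : measurable (@square R : set RR).
Proof. by apply: measurableX; exact: measurable_itv. Qed.

(** The Lebesgue measure lives on the measurable type measurableTypeR, whose
    measurable sets are the Borel sets of R under another display. *)
Lemma measurable_square_id : measurable_fun (@square R : set RR) (id : RR -> R * R).
Proof. exact: measurable_id. Qed.

Lemma measure_square : leb2 (@square R) = ((2 * pi) ^+ 2)%:E.
Proof.
rewrite product_measure1E//; try exact: measurable_itv.
have L : (@lebesgue_measure R) `[0, 2 * pi]%classic = (2 * pi)%:E.
  by rewrite lebesgue_measure_itv/= lte_fin mulr_gt0 ?pi_gt0// oppr0 adde0.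
by rewrite expr2 EFinM; congr (_ * _)%E; exact: L.
Qed.

Lemma measure_square_lty : (leb2 (@square R) < +oo)%E.
Proof. by rewrite measure_square ltry. Qed.

Section TrigonometricNorm.
Variables (K : nat) (w : 'I_K -> int * int) (a : 'I_K -> C).

Let iRe := square_integrable_Re_trig measurable_square measure_square_lty
  measurable_square_id w a.
Let iIm := square_integrable_Im_trig measurable_square measure_square_lty
  measurable_square_id w a.

Lemma sqnorm_square_trig :
  sqnorm_square (fun x => \sum_k a k * wave (w k) x) =
  \int[leb2]_(x in @square R) (complex.Re (\sum_k a k * wave (w k) x)) ^+ 2 +
  \int[leb2]_(x in @square R) (complex.Im (\sum_k a k * wave (w k) x)) ^+ 2.
Proof.
rewrite -(RintegralD measurable_square iRe.2 iIm.2).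
by apply: eq_Rintegral => x _; rewrite Re_conjM.
Qed.

(** Pointwise Cauchy-Schwarz rather than orthogonality, since the same
    frequency may be sampled several times; the factor K goes into the constant
    of the theorem. *)
Lemma sqnorm_square_trig_le :
  sqnorm_square (fun x => \sum_k a k * wave (w k) x) <=
  (2 * pi) ^+ 2 * (K%:R * \sum_k normsq (a k)).
Proof.
rewrite sqnorm_square_trig -(RintegralD measurable_square iRe.2 iIm.2).
have icst := square_integrable_integrable measurable_square measure_square_lty
  (square_integrable_cst measurable_square measure_square_lty
     (K%:R * \sum_k normsq (a k))).
rewrite [leRHS]mulrC -[X in _ <= _ * X]/(fine ((2 * pi) ^+ 2)%:E) -measure_square.
rewrite -Rintegral_cst; last exact: measurable_square.
apply: le_Rintegral; [exact: measurable_square| |by []|].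
  exact: (integrableD measurable_square iRe.2 iIm.2).
move=> x _; apply: (le_trans (normsq_sum _)); rewrite card_ord ler_wpM2l//.
by apply: ler_sum => k _; rewrite normsqM normsq_wave mulr1.
Qed.

End TrigonometricNorm.

End Square.

(** * Limits of Fourier expansions *)
Section ScalarSeries.
Variable R : realType.
Local Notation C := R[i].
Variables (c : int * int -> C) (g : R * R -> R).

Lemma Re_scaled_sum (A : {fset int * int}) (a : R) (x : R * R) :
  complex.Re (a%:C * \sum_(w <- A) c w * wave w x) =
  \sum_(w <- A) a * complex.Re (c w * wave w x).
Proof.
rewrite -mulr_sumr -Re_sum.
by case: (\sum_(w <- A) _) => p q /=; rewrite mul0r subr0.
Qed.

Lemma Im_scaled_sum (A : {fset int * int}) (a : R) (x : R * R) :
  complex.Im (a%:C * \sum_(w <- A) c w * wave w x) =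
  \sum_(w <- A) a * complex.Im (c w * wave w x).
Proof.
rewrite -mulr_sumr -Im_sum.
by case: (\sum_(w <- A) _) => p q /=; rewrite mul0r addr0.
Qed.

Hypothesis cg : forall x, square x ->
  (fun A : {fset int * int} => complex.Re (((2 * pi)^-1)%:C * \sum_(w <- A) c w * wave w x))
    @ summability.totally --> g x.

Let partial n x :=
  complex.Re (((2 * pi)^-1)%:C * \sum_(w <- @pickle_lt (int * int)%type n) c w * wave w x).

Let cvg_partial x : square x -> partial^~ x @ \oo --> g x.
Proof.
by move=> /cg; apply: cvg_comp; exact: pickle_lt_totally.
Qed.

Lemma measurable_series_limit : measurable_fun (@square R) g.
Proof.
apply: (@measurable_fun_cvg _ _ _ _ partial) => // n.
rewrite /partial; under eq_fun do rewrite Re_scaled_sum.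
apply: measurable_sum => w; apply: measurable_funM => //.
by apply: measurable_funTS; exact: measurable_Re_wave.
Qed.

Lemma series_limit_bounded (b : int * int -> R) (S : R) :
  (forall w, normsq (c w) <= b w ^+ 2) -> (forall w, 0 <= b w) ->
  (forall A : {fset int * int}, \sum_(w <- A) b w <= S) ->
  forall x, square x -> `|g x| <= (2 * pi)^-1 * S.
Proof.
move=> cb b0 bS x sx.
have pi0 : 0 <= (2 * pi)^-1 :> R by rewrite invr_ge0 mulr_ge0// pi_ge0.
have bd n : `|partial n x| <= (2 * pi)^-1 * S.
  rewrite /partial Re_scaled_sum -mulr_sumr normrM ger0_norm// ler_wpM2l//.
  apply: le_trans (bS (@pickle_lt (int * int)%type n)).
  apply: (le_trans (ler_norm_sum _ _ _)); apply: ler_sum => w _.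
  rewrite -ler_sqr ?nnegrE// real_normK ?num_real//.
  apply: le_trans (cb w); rewrite -[normsq (c w)]mulr1 -(normsq_wave w x) -normsqM.
  by rewrite lerDl sqr_ge0.
have := cvg_partial sx => gx.
have -> : g x = lim (partial^~ x @ \oo) by apply/esym/cvg_lim.
have cv : cvgn (partial^~ x) by apply/cvg_ex; exists (g x).
rewrite ler_norml; apply/andP; split.
  by apply: limr_ge => //; apply: nearW => n; have := bd n; rewrite ler_norml => /andP[].
by apply: limr_le => //; apply: nearW => n; have := bd n; rewrite ler_norml => /andP[].
Qed.

End ScalarSeries.

(** * The risk as a quadratic function of the coefficients *)
Section Coefficients.
Variable R : realType.
Local Notation C := R[i].
Variable K : nat.

(** The rows are the real and imaginary parts of the two components: the risk
    is quadratic over the reals, not over the complex numbers. *)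
Definition coeffs (v : 'M[R]_(4, K)) (k : 'I_K) : C * C :=
  (v (inord 0) k +i* v (inord 1) k, v (inord 2) k +i* v (inord 3) k).

Lemma coeffs_surj (b : 'I_K -> C * C) : exists v, coeffs v = b.
Proof.
exists (\matrix_(i, k) nth 0 [:: complex.Re (b k).1; complex.Im (b k).1;
  complex.Re (b k).2; complex.Im (b k).2] i).
apply/funext => k; rewrite /coeffs !mxE !inordK//=.
by case: (b k) => -[p q] [r s].
Qed.

Variables A B : 'I_K -> C.

Lemma linear_form_Re_coeffs : linear_form (fun v : 'M[R]_(4, K) =>
  complex.Re (\sum_k (A k * (coeffs v k).1 + B k * (coeffs v k).2))).
Proof.
move=> a u v; rewrite !Re_sum mulr_sumr -big_split; apply: eq_bigr => k _.
by rewrite /coeffs !mxE; case: (A k) => p q; case: (B k) => r s /=; ring.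
Qed.

Lemma linear_form_Im_coeffs : linear_form (fun v : 'M[R]_(4, K) =>
  complex.Im (\sum_k (A k * (coeffs v k).1 + B k * (coeffs v k).2))).
Proof.
move=> a u v; rewrite !Im_sum mulr_sumr -big_split; apply: eq_bigr => k _.
by rewrite /coeffs !mxE; case: (A k) => p q; case: (B k) => r s /=; ring.
Qed.

End Coefficients.

Section QuadraticRisk.
Variable R : realType.
Local Notation C := R[i].
Variables (K : nat) (w : 'I_K -> int * int).

Lemma quadratic_sqnorm_diff_op (M : nat) (alpha : 'I_M -> nat * nat) (c : 'I_M -> C * C) :
  quadratic (fun v : 'M[R]_(4, K) =>
    sqnorm_square (diff_op alpha c (model w (coeffs v)))).
Proof.
have s0 := square_integrable_cst (@measurable_square R) (@measure_square_lty R) 0.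
have E v : sqnorm_square (diff_op alpha c (model w (coeffs v))) =
  \int[(@lebesgue_measure R \x @lebesgue_measure R)%E]_(x in @square R)
    (complex.Re (\sum_k diff_coef alpha c (w k) (coeffs v k) * wave (w k) x) - 0) ^+ 2 +
  \int[(@lebesgue_measure R \x @lebesgue_measure R)%E]_(x in @square R)
    (complex.Im (\sum_k diff_coef alpha c (w k) (coeffs v k) * wave (w k) x) - 0) ^+ 2.
  rewrite diff_op_model sqnorm_square_trig.
  by congr (_ + _); apply: eq_Rintegral => x _; rewrite subr0.
rewrite (funext E).
have lin x v : \sum_k diff_coef alpha c (w k) (coeffs v k) * wave (w k) x =
   \sum_k (wave (w k) x * symbol alpha (fun m => (c m).1) (w k) * (coeffs v k).1 +
           wave (w k) x * symbol alpha (fun m => (c m).2) (w k) * (coeffs v k).2).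
  by apply: eq_bigr => k _; rewrite /diff_coef mulrC mulrDr !mulrA.
refine (quadraticD _ _).
- apply: quadratic_integral => //.
  + exact: measurable_square.
  + by move=> x a u v; rewrite !lin linear_form_Re_coeffs.
  + move=> v; apply: square_integrable_Re_trig; first exact: measurable_square.
      exact: measure_square_lty.
    exact: measurable_square_id.
- apply: quadratic_integral => //.
  + exact: measurable_square.
  + by move=> x a u v; rewrite !lin linear_form_Im_coeffs.
  + move=> v; apply: square_integrable_Im_trig; first exact: measurable_square.
      exact: measure_square_lty.
    exact: measurable_square_id.
Qed.

Context d (T : measurableType d) (P : probability T R).
Variables (x : T -> R * R) (y : T -> R).
Hypothesis mx : measurable_fun setT x.
Hypothesis iy : square_integrable P setT y.

Let PT : (P setT < +oo)%E. Proof. by rewrite probability_setT ltry. Qed.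

Lemma quadratic_fit_Re (e : C * C -> C) :
  (e = fst \/ e = snd) ->
  quadratic (fun v : 'M[R]_(4, K) =>
    \int[P]_t (complex.Re (\sum_k e (coeffs v k) * wave (w k) (x t)) - y t) ^+ 2).
Proof.
move=> He; apply: quadratic_integral => //.
  move=> t a u v.
  case: He => ->.
    have lin z : \sum_k (coeffs z k).1 * wave (w k) (x t) =
      \sum_k (wave (w k) (x t) * (coeffs z k).1 + 0 * (coeffs z k).2).
      by apply: eq_bigr => k _; rewrite mul0r addr0 mulrC.
    by rewrite !lin linear_form_Re_coeffs.
  have lin z : \sum_k (coeffs z k).2 * wave (w k) (x t) =
    \sum_k (0 * (coeffs z k).1 + wave (w k) (x t) * (coeffs z k).2).
    by apply: eq_bigr => k _; rewrite mul0r add0r mulrC.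
  by rewrite !lin linear_form_Re_coeffs.
by move=> v; exact: square_integrable_Re_trig.
Qed.

Lemma quadratic_fit_Im (e : C * C -> C) :
  (e = fst \/ e = snd) ->
  quadratic (fun v : 'M[R]_(4, K) =>
    \int[P]_t (complex.Im (\sum_k e (coeffs v k) * wave (w k) (x t)) - y t) ^+ 2).
Proof.
move=> He; apply: quadratic_integral => //.
  move=> t a u v.
  case: He => ->.
    have lin z : \sum_k (coeffs z k).1 * wave (w k) (x t) =
      \sum_k (wave (w k) (x t) * (coeffs z k).1 + 0 * (coeffs z k).2).
      by apply: eq_bigr => k _; rewrite mul0r addr0 mulrC.
    by rewrite !lin linear_form_Im_coeffs.
  have lin z : \sum_k (coeffs z k).2 * wave (w k) (x t) =
    \sum_k (0 * (coeffs z k).1 + wave (w k) (x t) * (coeffs z k).2).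
    by apply: eq_bigr => k _; rewrite mul0r add0r mulrC.
  by rewrite !lin linear_form_Im_coeffs.
by move=> v; exact: square_integrable_Im_trig.
Qed.

End QuadraticRisk.

(** * Bias-noise decomposition of the risk *)
Section Risk.
Context (R : realType) (disp : measure_display) (T : measurableType disp)
  (P : probability T R).
Local Notation C := R[i].
Variables (f : R * R -> R * R) (fhat : int * int -> C * C).
Hypothesis Hf : fourier_expansion f fhat.
Variable S : R.
Hypothesis HS : (\esum_(w in [set: int * int]) (cnorm (fhat w))%:E = S%:E)%E.
Variables (x eps : {RV P >-> (R * R)%type}) (sigma : R).
Hypothesis Hx : forall t, square (x t).
Hypothesis Hindep : independent P x eps.
Hypothesis Heps1 : ('E_P[fun t => (eps t).1] = 0)%E.
Hypothesis Heps2 : ('E_P[fun t => (eps t).2] = 0)%E.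
Hypothesis Hsigma : ('E_P[fun t => (enorm (eps t) ^+ 2)%R] = (sigma ^+ 2)%:E)%E.

Let PT : (P setT < +oo)%E. Proof. by rewrite probability_setT ltry. Qed.

Lemma partial_mass_le (A : {fset int * int}) : \sum_(w <- A) cnorm (fhat w) <= S.
Proof.
rewrite -lee_fin -HS; apply: esum_ge; exists [set` A] => //.
by rewrite fsbig_finite//= set_fsetK sumEFin.
Qed.

(** The components of f cut off outside the square: nothing is known about the
    measurability of f there, and the sample point never leaves the square. *)
Definition field1 : R * R -> R := (fun y => (f y).1) \_ (@square R).
Definition field2 : R * R -> R := (fun y => (f y).2) \_ (@square R).

Lemma field1E y : square y -> field1 y = (f y).1.
Proof. by move=> sy; rewrite /field1 patchE mem_set. Qed.

Lemma field2E y : square y -> field2 y = (f y).2.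
Proof. by move=> sy; rewrite /field2 patchE mem_set. Qed.

Let msq : measurable (@square R).
Proof. exact: measurable_square. Qed.

Lemma measurable_field1 : measurable_fun setT field1.
Proof.
apply/(measurable_restrictT _ msq).
by apply: (measurable_series_limit (c := fun w => (fhat w).1)) => y /Hf[[]].
Qed.

Lemma measurable_field2 : measurable_fun setT field2.
Proof.
apply/(measurable_restrictT _ msq).
by apply: (measurable_series_limit (c := fun w => (fhat w).2)) => y /Hf[_ []].
Qed.

Lemma square_integrable_field1 : square_integrable P setT (field1 \o x).
Proof.
apply: (bounded_square_integrable measurableT PT (M := (2 * pi)^-1 * S)).
  exact: measurableT_comp measurable_field1 (measurable_funP x).
move=> t _; rewrite /= field1E//.
apply: (series_limit_bounded (c := fun w => (fhat w).1)
  (g := fun y => (f y).1) _ (b := fun w => cnorm (fhat w))) => //.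
- by move=> y /Hf[[]].
- by move=> w; rewrite cnorm_sqr lerDl normsq_ge0.
- by move=> w; exact: cnorm_ge0.
- exact: partial_mass_le.
Qed.

Lemma square_integrable_field2 : square_integrable P setT (field2 \o x).
Proof.
apply: (bounded_square_integrable measurableT PT (M := (2 * pi)^-1 * S)).
  exact: measurableT_comp measurable_field2 (measurable_funP x).
move=> t _; rewrite /= field2E//.
apply: (series_limit_bounded (c := fun w => (fhat w).2)
  (g := fun y => (f y).2) _ (b := fun w => cnorm (fhat w))) => //.
- by move=> y /Hf[_ []].
- by move=> w; rewrite cnorm_sqr lerDr normsq_ge0.
- by move=> w; exact: cnorm_ge0.
- exact: partial_mass_le.
Qed.

Lemma enorm_sqr (v : R * R) : enorm v ^+ 2 = v.1 ^+ 2 + v.2 ^+ 2.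
Proof. by rewrite sqr_sqrtr// addr_ge0 ?sqr_ge0. Qed.

Lemma measurable_eps1 : measurable_fun setT (fun t => (eps t).1).
Proof. exact: measurableT_comp measurable_fst (measurable_funP eps). Qed.

Lemma measurable_eps2 : measurable_fun setT (fun t => (eps t).2).
Proof. exact: measurableT_comp measurable_snd (measurable_funP eps). Qed.

Lemma integrable_enorm_eps : P.-integrable setT (EFin \o (fun t => enorm (eps t) ^+ 2)).
Proof.
apply/integrableP; split.
  apply/measurable_EFinP; under eq_fun do rewrite enorm_sqr.
  apply: measurable_funD; apply: measurable_funX.
    exact: measurable_eps1.
  exact: measurable_eps2.
move: Hsigma; rewrite unlock => E.
under eq_integral do rewrite /= ger0_norm ?sqr_ge0//.
by rewrite E ltry.
Qed.

Lemma square_integrable_eps1 : square_integrable P setT (fun t => (eps t).1).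
Proof.
apply: (le_square_integrable measurableT measurable_eps1 integrable_enorm_eps).
by move=> t _; rewrite enorm_sqr lerDl sqr_ge0.
Qed.

Lemma square_integrable_eps2 : square_integrable P setT (fun t => (eps t).2).
Proof.
apply: (le_square_integrable measurableT measurable_eps2 integrable_enorm_eps).
by move=> t _; rewrite enorm_sqr lerDr sqr_ge0.
Qed.

Lemma integral_noise (g e : R * R -> R) :
  measurable_fun setT g -> square_integrable P setT (g \o x) ->
  measurable_fun setT e -> square_integrable P setT (e \o eps) ->
  ('E_P[e \o eps] = 0)%E -> \int[P]_t (g (x t) * e (eps t)) = 0.
Proof.
move=> mg ig me ie e0.
rewrite (independent_integralM (g := g) (h := e) Hindep mg me ig ie).
by move: e0; rewrite unlock /Rintegral => ->; rewrite /= mulr0.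
Qed.

Variable K : nat.
Implicit Types (w : 'I_K -> int * int) (b : 'I_K -> C * C).

(** Squared distance between the model and the field at y, by real and
    imaginary parts of the two components. The subtracted 0 is the imaginary
    part of the field, so that the four terms have the same shape. *)
Definition misfit w b (y : R * R) : R :=
  ((complex.Re (\sum_k (b k).1 * wave (w k) y) - field1 y) ^+ 2
   + (complex.Im (\sum_k (b k).1 * wave (w k) y) - 0) ^+ 2)
  + ((complex.Re (\sum_k (b k).2 * wave (w k) y) - field2 y) ^+ 2
   + (complex.Im (\sum_k (b k).2 * wave (w k) y) - 0) ^+ 2).

Lemma misfit_ge0 w b y : 0 <= misfit w b y.
Proof. by rewrite !addr_ge0 ?sqr_ge0. Qed.

Section Misfit.
Variables (w : 'I_K -> int * int) (b : 'I_K -> C * C).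

Let iRe (a : 'I_K -> C) := square_integrable_Re_trig measurableT PT (measurable_funP x) w a.
Let iIm (a : 'I_K -> C) := square_integrable_Im_trig measurableT PT (measurable_funP x) w a.
Let i0 := square_integrable_cst measurableT PT 0.
Let i1 := square_integrableB measurableT (iRe (fun k => (b k).1)) square_integrable_field1.
Let i2 := square_integrableB measurableT (iIm (fun k => (b k).1)) i0.
Let i3 := square_integrableB measurableT (iRe (fun k => (b k).2)) square_integrable_field2.
Let i4 := square_integrableB measurableT (iIm (fun k => (b k).2)) i0.

Lemma integrable_misfit : P.-integrable setT (EFin \o (fun t => misfit w b (x t))).
Proof.
exact: (integrableD measurableT (integrableD measurableT i1.2 i2.2)
         (integrableD measurableT i3.2 i4.2)).
Qed.

Lemma integral_misfit : \int[P]_t misfit w b (x t) =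
  (\int[P]_t (complex.Re (\sum_k (b k).1 * wave (w k) (x t)) - field1 (x t)) ^+ 2
   + \int[P]_t (complex.Im (\sum_k (b k).1 * wave (w k) (x t)) - 0) ^+ 2)
  + (\int[P]_t (complex.Re (\sum_k (b k).2 * wave (w k) (x t)) - field2 (x t)) ^+ 2
   + \int[P]_t (complex.Im (\sum_k (b k).2 * wave (w k) (x t)) - 0) ^+ 2).
Proof.
rewrite RintegralD//; last 2 first.
- exact: (integrableD measurableT i1.2 i2.2).
- exact: (integrableD measurableT i3.2 i4.2).
rewrite (RintegralD measurableT i1.2 i2.2).
by rewrite (RintegralD measurableT i3.2 i4.2).
Qed.

Variables (lambda : R) (L : (R * R -> C * C) -> R * R -> C).

(** In the expansion of the square the cross term vanishes, because the noise is
    centred and independent of the sample point. *)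
Lemma riskE : risk P lambda L f x eps w b =
  (\int[P]_t misfit w b (x t) + sigma ^+ 2 + lambda * sqnorm_square (L (model w b)))%:E.
Proof.
pose g1 y := complex.Re (\sum_k (b k).1 * wave (w k) y) - field1 y.
pose g2 y := complex.Re (\sum_k (b k).2 * wave (w k) y) - field2 y.
pose pen := lambda * sqnorm_square (L (model w b)).
have mRe (a : 'I_K -> C) : measurable_fun setT (fun y => complex.Re (\sum_k a k * wave (w k) y)).
  under eq_fun do rewrite Re_sum; apply: measurable_sum => k.
  exact: measurable_Re_wave.
have mg1 : measurable_fun setT g1 := measurable_funB (mRe _) measurable_field1.
have mg2 : measurable_fun setT g2 := measurable_funB (mRe _) measurable_field2.
have n1 : \int[P]_t (g1 (x t) * (eps t).1) = 0.
  exact: (integral_noise mg1 i1 measurable_fst square_integrable_eps1 Heps1).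
have n2 : \int[P]_t (g2 (x t) * (eps t).2) = 0.
  exact: (integral_noise mg2 i3 measurable_snd square_integrable_eps2 Heps2).
have j1 : P.-integrable setT (EFin \o (fun t => g1 (x t) * (eps t).1)).
  exact: (square_integrableM measurableT i1 square_integrable_eps1).
have j2 : P.-integrable setT (EFin \o (fun t => g2 (x t) * (eps t).2)).
  exact: (square_integrableM measurableT i3 square_integrable_eps2).
have j1D2 : P.-integrable setT
    (EFin \o (fun t => g1 (x t) * (eps t).1 + g2 (x t) * (eps t).2)).
  exact: (integrableD measurableT j1 j2).
have j12 : P.-integrable setT
    (EFin \o (fun t => 2 * (g1 (x t) * (eps t).1 + g2 (x t) * (eps t).2))).
  exact: (integrableZl measurableT 2 j1D2).
have jc := square_integrable_integrable measurableT PT (square_integrable_cst measurableT PT pen).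
have jm := integrable_misfit.
have je := integrable_enorm_eps.
have jme : P.-integrable setT
    (EFin \o (fun t => misfit w b (x t) + enorm (eps t) ^+ 2)).
  exact: (integrableD measurableT jm je).
have jmeb : P.-integrable setT (EFin \o (fun t => misfit w b (x t)
    + enorm (eps t) ^+ 2 - 2 * (g1 (x t) * (eps t).1 + g2 (x t) * (eps t).2))).
  exact: (integrableB measurableT jme j12).
rewrite /risk unlock.
have -> : (fun t => (loss lambda L (model w b) (x t) (f (x t) + eps t))%:E) =
    (fun t => ((misfit w b (x t) + enorm (eps t) ^+ 2
       - 2 * (g1 (x t) * (eps t).1 + g2 (x t) * (eps t).2)) + pen)%:E).
  apply/funext => t; congr _%:E; congr (_ + _).
  rewrite cnorm_sqr enorm_sqr /misfit /g1 /g2 /model /real_vec !field1E// !field2E//=.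
  rewrite /normsq/=.
  case: (\sum_k (b k).1 * wave (w k) (x t)) => p q.
  case: (\sum_k (b k).2 * wave (w k) (x t)) => r s /=.
  ring.
have -> : sigma ^+ 2 = \int[P]_t (enorm (eps t) ^+ 2).
  by move: Hsigma; rewrite unlock /Rintegral => ->.
rewrite -[LHS]fineK; last first.
  by apply: (integrable_fin_num measurableT); exact: (integrableD measurableT jmeb jc).
rewrite -[fine _]/(\int[P]_t (misfit w b (x t) + enorm (eps t) ^+ 2
       - 2 * (g1 (x t) * (eps t).1 + g2 (x t) * (eps t).2) + pen)).
rewrite (RintegralD measurableT jmeb jc) (RintegralB measurableT jme j12).
rewrite (RintegralD measurableT jm je) Rintegral_cstP.
rewrite (RintegralZl _ measurableT j1D2).
by rewrite (RintegralD measurableT j1 j2) n1 n2 addr0 mulr0 subr0.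
Qed.

End Misfit.

Lemma risk_min (lambda : R) (M : nat) (alpha : 'I_M -> nat * nat)
    (c : 'I_M -> C * C) w : 0 <= lambda ->
  exists b0, forall b, (risk P lambda (diff_op alpha c) f x eps w b0
                        <= risk P lambda (diff_op alpha c) f x eps w b)%E.
Proof.
move=> l0.
have i0 := square_integrable_cst measurableT PT 0.
have mx : measurable_fun setT x := measurable_funP x.
have Q1 := quadratic_fit_Re w mx square_integrable_field1 (or_introl (erefl _)).
have Q2 := quadratic_fit_Im w mx i0 (or_introl (erefl _)).
have Q3 := quadratic_fit_Re w mx square_integrable_field2 (or_intror (erefl _)).
have Q4 := quadratic_fit_Im w mx i0 (or_intror (erefl _)).
have Q5 := quadraticZ lambda (quadratic_sqnorm_diff_op w alpha c).
have Q := quadraticD (quadraticD (quadraticD Q1 Q2) (quadraticD Q3 Q4)) Q5.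
have [v|v0 v0P] := quadratic_min Q.
  apply: addr_ge0.
    by rewrite !addr_ge0//; apply: Rintegral_ge0 => t _; rewrite sqr_ge0.
  rewrite mulr_ge0//; apply: Rintegral_ge0 => y _.
  by rewrite Re_conjM normsq_ge0.
exists (coeffs v0) => b; have [v <-] := coeffs_surj b.
rewrite !riskE lee_fin !integral_misfit; have := v0P v; rewrite /=.
move=> h; rewrite !(addrAC _ (sigma ^+ 2)) lerD2r; exact: h.
Qed.

End Risk.

(** * Importance sampling of the frequencies *)

(** The integral of a nonnegative function is the supremum of the integrals of
    the simple functions below it. This applies to the infimum of the risk over
    all the coefficients. *)
Lemma le_integral_of_ge0 d (T : measurableType d) (R : realType)
    (mu : {measure set T -> \bar R}) (f g : T -> \bar R) :
  (forall t, 0 <= f t)%E -> (forall t, f t <= g t)%E ->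
  (\int[mu]_t f t <= \int[mu]_t g t)%E.
Proof.
move=> f0 fg; rewrite !ge0_integralTE//; last first.
  by move=> t; exact: le_trans (fg t).
apply: ereal_sup_le => _ [h hf <-].
by exists h => // t; exact: le_trans (hf t) (fg t).
Qed.

Section MomentBound.
Variables (R : realType) (d M : nat) (c : 'I_M -> R[i] * R[i]) (C : R).
Hypothesis C0 : 0 < C.

(** Bound for the root mean square of the symbol estimate. The two products by
    C bound the moments of order 4 d of the two components of the frequency;
    the final 1 makes the constant positive. *)
Definition penalty_cst : R :=
  Num.sqrt (3 * symbol_cst c ^+ 2 * 1 + 3 * symbol_cst c ^+ 2 * (1 * C + 1 * C)) + 1.

Lemma penalty_cst_gt0 : 0 < penalty_cst.
Proof. by rewrite ltr_wpDl ?sqrtr_ge0. Qed.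

Lemma Erho_symbol_bound (rho : int * int -> R) : admissible d C rho ->
  (Erho rho (fun v => (symbol_cst c * growth R d v) ^+ 2)%R
   <= (penalty_cst ^+ 2)%:E)%E.
Proof.
move=> Hrho; have [rpos _ mom] := Hrho.
have rho0 v : 0 <= rho v by rewrite ltW.
have D0 : 0 <= 3 * symbol_cst c ^+ 2 by rewrite mulr_ge0// sqr_ge0.
have [/ltW m1 /ltW m2] := mom (4 * d)%N (leqnn _).
have m12 : (Erho rho (fun v => `|v.1%:~R| ^+ (4 * d) + `|v.2%:~R| ^+ (4 * d))%R
            <= (1 * C + 1 * C)%:E)%E.
  by apply: (Erho_le rho0 _ _ _ m1 m2) => // v; rewrite !mul1r.
have e1 : (Erho rho (fun=> 1%R) <= 1%:E)%E by rewrite (admissible_sum1 Hrho).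
apply: (@le_trans _ _ (3 * symbol_cst c ^+ 2 * 1
                       + 3 * symbol_cst c ^+ 2 * (1 * C + 1 * C))%:E).
  apply: (Erho_le rho0 D0 D0 _ e1 m12) => v.
  have e4 (r : R) : r ^+ (4 * d) = (r ^+ (2 * d)) ^+ 2.
    by rewrite -exprM mulnAC.
  rewrite exprMn /growth !e4; move: (`|_| ^+ _) (`|_| ^+ _) => p q.
  have h : (1 + (p + q)) ^+ 2 <= 3 * (1 + (p ^+ 2 + q ^+ 2)).
    have := sqr_ge0 (p - q); have := sqr_ge0 (p - 1); have := sqr_ge0 (q - 1).
    by rewrite !expr2; lra.
  by have := ler_wpM2l (sqr_ge0 (symbol_cst c)) h; lra.
rewrite lee_fin /penalty_cst.
set s := _ + _ * (1 * C + _).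
have s0 : 0 <= s by have := mulr_ge0 D0 (ltW C0); rewrite /s; lra.
rewrite -{1}(sqr_sqrtr s0) lerXn2r ?nnegrE ?addr_ge0 ?sqrtr_ge0//.
by rewrite lerDl.
Qed.

End MomentBound.

Section Sampling.
Variables (R : realType) (d' : measure_display) (T' : measurableType d')
  (Q : probability T' R) (K : nat) (rho : int * int -> R)
  (w : 'I_K -> T' -> int * int).
Hypothesis K0 : (0 < K)%N.
Hypothesis iidw : iid Q rho w.

Lemma measurable_sample d2 (U : measurableType d2) (g : int * int -> U) k :
  measurable_fun setT (fun t => g (w k t)).
Proof. by have [mw _ _] := iidw; exact: (measurable_countable_comp (mw k) g). Qed.

Lemma ge0_integral_sample (g : int * int -> R) k : (forall v, 0 <= g v) ->
  (\int[Q]_t (g (w k t))%:E <= Erho rho g)%E.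
Proof.
have [mw Pw _] := iidw => g0.
exact: (ge0_integral_countable_law (mw k) (Pw k)).
Qed.

Lemma integrable_sample (g : int * int -> R) (G : R) k : (forall v, 0 <= g v) ->
  (Erho rho g <= G%:E)%E -> Q.-integrable setT (EFin \o (fun t => g (w k t))).
Proof.
move=> g0 gG; apply/integrableP; split.
  exact: (measurable_sample (EFin \o g)).
under eq_integral do rewrite /= ger0_norm//.
apply: le_lt_trans (ge0_integral_sample k g0) _.
by apply: le_lt_trans gG _; rewrite ltry.
Qed.

Lemma Rintegral_sample_le (g : int * int -> R) (G : R) k : (forall v, 0 <= g v) ->
  (Erho rho g <= G%:E)%E -> \int[Q]_t g (w k t) <= G.
Proof.
move=> g0 gG; rewrite -lee_fin /Rintegral fineK.
  exact: le_trans (ge0_integral_sample k g0) gG.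
by apply: (integrable_fin_num measurableT); exact: (integrable_sample _ g0 gG).
Qed.

(** The dominating function n makes all the z (w k) square-integrable at
    once. *)
Lemma sample_mean_error (n z : int * int -> R) (G m : R) :
  (Erho rho n <= G%:E)%E -> (forall v, z v ^+ 2 <= n v) ->
  (fun A : {fset int * int} => \sum_(v <- A) z v * rho v) @ summability.totally --> m ->
  (forall k, square_integrable Q setT (fun t => z (w k t))) /\
  \int[Q]_t (K%:R^-1 * (\sum_k z (w k t)) - m) ^+ 2 =
    K%:R^-1 ^+ 2 * \sum_k (\int[Q]_t (z (w k t) ^+ 2) - m ^+ 2).
Proof.
move=> nG zn zm; have [mw Pw _] := iidw.
have QT : (Q setT < +oo)%E by rewrite probability_setT ltry.
have n0 v : 0 <= n v := le_trans (sqr_ge0 _) (zn v).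
have iz k : square_integrable Q setT (fun t => z (w k t)).
  apply: (le_square_integrable measurableT _ (integrable_sample k n0 nG)).
    exact: measurable_sample.
  by move=> t _; exact: zn.
split=> //; apply: mean_square_average => //.
  move=> k; apply: (Rintegral_countable_law (mw k) (Pw k) _ zm).
  exact: (square_integrable_integrable measurableT QT (iz k)).
by move=> k l kl; exact: (iid_uncorrelated iidw kl (iz k) (iz l)).
Qed.

End Sampling.

Section SampledModel.
Context (R : realType) (f : R * R -> R * R) (fhat : int * int -> R[i] * R[i]).
Local Notation C := R[i].
Hypothesis Hf : fourier_expansion f fhat.
Variable rho : int * int -> R.
Hypothesis rpos : forall v, 0 < rho v.

Definition ratio v := cnorm (fhat v) / rho v.

(** Importance weight: the mean of amplitude w * wave w y under rho is the
    Fourier expansion at y. *)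
Definition amplitude v : C * C :=
  (((2 * pi * rho v)^-1)%:C * (fhat v).1, ((2 * pi * rho v)^-1)%:C * (fhat v).2).

Lemma normsqZ (a : R) (z : C) : normsq (a%:C * z) = a ^+ 2 * normsq z.
Proof. by rewrite normsqM {1}/normsq/= expr0n addr0. Qed.

Lemma ReZ (a : R) (z : C) : complex.Re (a%:C * z) = a * complex.Re z.
Proof. by case: z => p q /=; rewrite mul0r subr0. Qed.

Lemma ImZ (a : R) (z : C) : complex.Im (a%:C * z) = a * complex.Im z.
Proof. by case: z => p q /=; rewrite mul0r addr0. Qed.

Lemma cnorm_amplitude v : cnorm (amplitude v) ^+ 2 = ((2 * pi) ^+ 2)^-1 * ratio v ^+ 2.
Proof.
rewrite cnorm_sqr !normsqZ -mulrDr -cnorm_sqr /ratio.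
have := gt_eqF (pi_gt0 R); have := gt_eqF (rpos v).
by move: pi => p r0 p0; field; rewrite r0 p0.
Qed.

Lemma amplitude_series_Re (c : int * int -> C) (A : {fset int * int}) (y : R * R) :
  \sum_(v <- A) (2 * pi)^-1 * complex.Re (c v * wave v y) =
  \sum_(v <- A) complex.Re (((2 * pi * rho v)^-1)%:C * c v * wave v y) * rho v.
Proof.
apply: eq_bigr => v _; rewrite -[in RHS]mulrA ReZ.
have := gt_eqF (pi_gt0 R); have := gt_eqF (rpos v).
by move: (complex.Re _) pi => q p r0 p0; field; rewrite r0 p0.
Qed.

Lemma amplitude_series_Im (c : int * int -> C) (A : {fset int * int}) (y : R * R) :
  \sum_(v <- A) (2 * pi)^-1 * complex.Im (c v * wave v y) =
  \sum_(v <- A) complex.Im (((2 * pi * rho v)^-1)%:C * c v * wave v y) * rho v.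
Proof.
apply: eq_bigr => v _; rewrite -[in RHS]mulrA ImZ.
have := gt_eqF (pi_gt0 R); have := gt_eqF (rpos v).
by move: (complex.Im _) pi => q p r0 p0; field; rewrite r0 p0.
Qed.

Context (d' : measure_display) (T' : measurableType d')
  (Q : probability T' R) (K : nat) (w : 'I_K -> T' -> int * int).
Hypothesis K0 : (0 < K)%N.
Hypothesis iidw : iid Q rho w.
Variable V : R.
Hypothesis ratioV : (Erho rho (fun v => ratio v ^+ 2)%R <= V%:E)%E.

Definition sampled_coeff (t : T') (k : 'I_K) : C * C :=
  ((K%:R^-1)%:C * (amplitude (w k t)).1, (K%:R^-1)%:C * (amplitude (w k t)).2).

(** Sum of the mean square errors of the four real components, whose variances
    add up to that of the amplitude; the values subtracted are the components of
    f y and zeros. *)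
Lemma integral_misfit_sample (y : R * R) : square y ->
  (\int[Q]_t (misfit f (w^~ t) (sampled_coeff t) y)%:E
   <= (K%:R^-1 * (((2 * pi) ^+ 2)^-1 * V - enorm (f y) ^+ 2))%:E)%E.
Proof.
move=> sy; have [[e1R e1I] [e2R e2I]] := Hf sy.
pose n v := cnorm (amplitude v) ^+ 2.
pose G := ((2 * pi) ^+ 2)^-1 * V.
have rho0 v : 0 <= rho v by rewrite ltW.
have n0 v : 0 <= n v by rewrite sqr_ge0.
have nG : (Erho rho n <= G%:E)%E.
  rewrite -[G]addr0 -(mul0r V); apply: (Erho_le rho0 _ _ _ ratioV ratioV) => //.
    by rewrite invr_ge0 sqr_ge0.
  by move=> v; rewrite mul0r addr0 /n cnorm_amplitude.
have bd v : normsq (amplitude v).1 + normsq (amplitude v).2 = n v.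
  by rewrite /n cnorm_sqr.
have nw z v : normsq z = complex.Re (z * wave v y) ^+ 2 + complex.Im (z * wave v y) ^+ 2.
  by rewrite -[LHS]mulr1 -(normsq_wave v y) -normsqM.
have b1 v := nw (amplitude v).1 v; have b2 v := nw (amplitude v).2 v.
pose z1 v := complex.Re ((amplitude v).1 * wave v y).
pose z2 v := complex.Im ((amplitude v).1 * wave v y).
pose z3 v := complex.Re ((amplitude v).2 * wave v y).
pose z4 v := complex.Im ((amplitude v).2 * wave v y).
have zn v : n v = z1 v ^+ 2 + z2 v ^+ 2 + (z3 v ^+ 2 + z4 v ^+ 2).
  by rewrite -bd b1 b2.
have zle v : [/\ z1 v ^+ 2 <= n v, z2 v ^+ 2 <= n v, z3 v ^+ 2 <= n v
    & z4 v ^+ 2 <= n v].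
  have := sqr_ge0 (z1 v); have := sqr_ge0 (z2 v).
  have := sqr_ge0 (z3 v); have := sqr_ge0 (z4 v).
  by rewrite zn; split; lra.
have s1 v : z1 v ^+ 2 <= n v by case: (zle v).
have s2 v : z2 v ^+ 2 <= n v by case: (zle v).
have s3 v : z3 v ^+ 2 <= n v by case: (zle v).
have s4 v : z4 v ^+ 2 <= n v by case: (zle v).
have m1 : (fun A : {fset int * int} => \sum_(v <- A) z1 v * rho v)
    @ summability.totally --> field1 f y.
  rewrite field1E//; move: e1R; under eq_fun do rewrite Re_scaled_sum.
  by under eq_fun do rewrite amplitude_series_Re.
have m2 : (fun A : {fset int * int} => \sum_(v <- A) z2 v * rho v)
    @ summability.totally --> (0 : R).
  move: e1I; under eq_fun do rewrite Im_scaled_sum.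
  by under eq_fun do rewrite amplitude_series_Im.
have m3 : (fun A : {fset int * int} => \sum_(v <- A) z3 v * rho v)
    @ summability.totally --> field2 f y.
  rewrite field2E//; move: e2R; under eq_fun do rewrite Re_scaled_sum.
  by under eq_fun do rewrite amplitude_series_Re.
have m4 : (fun A : {fset int * int} => \sum_(v <- A) z4 v * rho v)
    @ summability.totally --> (0 : R).
  move: e2I; under eq_fun do rewrite Im_scaled_sum.
  by under eq_fun do rewrite amplitude_series_Im.
have [i1 E1] := sample_mean_error K0 iidw nG s1 m1.
have [i2 E2] := sample_mean_error K0 iidw nG s2 m2.
have [i3 E3] := sample_mean_error K0 iidw nG s3 m3.
have [i4 E4] := sample_mean_error K0 iidw nG s4 m4.
have QT : (Q setT < +oo)%E by rewrite probability_setT ltry.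
have ia z m (iz : forall k, square_integrable Q setT (fun t => z (w k t))) :
    Q.-integrable setT (EFin \o (fun t => (K%:R^-1 * (\sum_k z (w k t)) - m) ^+ 2)).
  have := square_integrableB measurableT
    (square_integrableZ measurableT K%:R^-1
      (square_integrable_sum measurableT QT (index_enum 'I_K) iz))
    (square_integrable_cst measurableT QT m).
  by case.
have a1 := ia _ (field1 f y) i1; have a2 := ia _ 0 i2.
have a3 := ia _ (field2 f y) i3; have a4 := ia _ 0 i4.
pose err t := ((K%:R^-1 * (\sum_k z1 (w k t)) - field1 f y) ^+ 2
   + (K%:R^-1 * (\sum_k z2 (w k t)) - 0) ^+ 2)
   + ((K%:R^-1 * (\sum_k z3 (w k t)) - field2 f y) ^+ 2
   + (K%:R^-1 * (\sum_k z4 (w k t)) - 0) ^+ 2).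
have -> : (\int[Q]_t (misfit f (w^~ t) (sampled_coeff t) y)%:E = \int[Q]_t (err t)%:E)%E.
  apply: eq_integral => t _; congr _%:E; rewrite /misfit /err /sampled_coeff/=.
  rewrite !Re_sum !Im_sum !mulr_sumr.
  by congr ((_ - _) ^+ 2 + (_ - _) ^+ 2 + ((_ - _) ^+ 2 + (_ - _) ^+ 2));
    apply: eq_bigr => k _; rewrite -mulrA ?ReZ ?ImZ.
have a12 := integrableD measurableT a1 a2.
have a34 := integrableD measurableT a3 a4.
rewrite -[leLHS]fineK; last first.
  exact: (integrable_fin_num measurableT (integrableD measurableT a12 a34)).
rewrite lee_fin -[leLHS]/(\int[Q]_t err t).
rewrite RintegralD// (RintegralD measurableT a1 a2) (RintegralD measurableT a3 a4).
rewrite E1 E2 E3 E4 -!mulrDr -!big_split/=.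
have -> : K%:R^-1 * (G - enorm (f y) ^+ 2) =
    K%:R^-1 ^+ 2 * \sum_(k < K) (G - enorm (f y) ^+ 2).
  rewrite sumr_const card_ord -[X in _ = _ * X]mulr_natl mulrA expr2.
  rewrite -[X in _ = X * _]mulrA.
  by rewrite mulVf ?mulr1// pnatr_eq0 -lt0n.
apply: ler_wpM2l; first exact: sqr_ge0.
apply: ler_sum => k _.
have En : \int[Q]_t n (w k t) = \int[Q]_t (z1 (w k t) ^+ 2) + \int[Q]_t (z2 (w k t) ^+ 2)
    + (\int[Q]_t (z3 (w k t) ^+ 2) + \int[Q]_t (z4 (w k t) ^+ 2)).
  rewrite -(RintegralD measurableT (i1 k).2 (i2 k).2).
  rewrite -(RintegralD measurableT (i3 k).2 (i4 k).2).
  rewrite -RintegralD//.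
  - by apply: eq_Rintegral => t _; rewrite zn.
  - exact: (integrableD measurableT (i1 k).2 (i2 k).2).
  - exact: (integrableD measurableT (i3 k).2 (i4 k).2).
have := Rintegral_sample_le iidw k n0 nG; rewrite En.
rewrite field1E// field2E// enorm_sqr; lra.
Qed.

(** Joint measurability, needed to exchange the integrals over the frequencies
    and over the sample point. *)
Lemma measurable_misfit_sample disp (T : measurableType disp) (x : T -> R * R) :
  measurable_fun setT x ->
  measurable_fun setT (field1 f) -> measurable_fun setT (field2 f) ->
  measurable_fun setT (fun p : T' * T => misfit f (w^~ p.1) (sampled_coeff p.1) (x p.2)).
Proof.
move=> mx mf1 mf2.
have mw (g : int * int -> R) k : measurable_fun setT (fun p : T' * T => g (w k p.1)).
  exact: measurableT_comp (measurable_sample iidw g k) measurable_fst.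
have mx2 : measurable_fun setT (fun p : T' * T => x p.2).
  exact: measurableT_comp mx measurable_snd.
have mx21 : measurable_fun setT (fun p : T' * T => (x p.2).1).
  exact: measurableT_comp measurable_fst mx2.
have mx22 : measurable_fun setT (fun p : T' * T => (x p.2).2).
  exact: measurableT_comp measurable_snd mx2.
have mph k : measurable_fun setT (fun p : T' * T => phase (w k p.1) (x p.2)).
  apply: measurable_funD; apply: measurable_funM => //.
    exact: (mw (fun v => v.1%:~R)).
  exact: (mw (fun v => v.2%:~R)).
have mcos k : measurable_fun setT (fun p : T' * T => cos (phase (w k p.1) (x p.2))).
  apply: measurableT_comp (mph k); apply: continuous_measurable_fun.
  exact: continuous_cos.
have msin k : measurable_fun setT (fun p : T' * T => sin (phase (w k p.1) (x p.2))).
  apply: measurableT_comp (mph k); apply: continuous_measurable_fun.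
  exact: continuous_sin.
have mRe (a : int * int -> C) : measurable_fun setT (fun p : T' * T =>
    complex.Re (\sum_k a (w k p.1) * wave (w k p.1) (x p.2))).
  under eq_fun do rewrite Re_sum; apply: measurable_sum => k.
  under eq_fun do rewrite Re_wave.
  apply: measurable_funB; apply: measurable_funM => //.
    exact: (mw (fun v => complex.Re (a v))).
  exact: (mw (fun v => complex.Im (a v))).
have mIm (a : int * int -> C) : measurable_fun setT (fun p : T' * T =>
    complex.Im (\sum_k a (w k p.1) * wave (w k p.1) (x p.2))).
  under eq_fun do rewrite Im_sum; apply: measurable_sum => k.
  under eq_fun do rewrite Im_wave.
  apply: measurable_funD; apply: measurable_funM => //.
    exact: (mw (fun v => complex.Re (a v))).
  exact: (mw (fun v => complex.Im (a v))).
apply: measurable_funD; apply: measurable_funD; apply: measurable_funX;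
  apply: measurable_funB => //.
- exact: (mRe (fun v => (K%:R^-1)%:C * (amplitude v).1)).
- exact: measurableT_comp mf1 mx2.
- exact: (mIm (fun v => (K%:R^-1)%:C * (amplitude v).1)).
- exact: (mRe (fun v => (K%:R^-1)%:C * (amplitude v).2)).
- exact: measurableT_comp mf2 mx2.
- exact: (mIm (fun v => (K%:R^-1)%:C * (amplitude v).2)).
Qed.

Variables (d M : nat) (alpha : 'I_M -> nat * nat) (c : 'I_M -> C * C).
Hypothesis Halpha : forall m, ((alpha m).1 + (alpha m).2 <= d)%N.

Lemma sqnorm_sample_le t :
  sqnorm_square (diff_op alpha c (model (w^~ t) (sampled_coeff t))) <=
  K%:R^-1 * \sum_k (ratio (w k t) ^+ 2 * (symbol_cst c * growth R d (w k t))).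
Proof.
rewrite diff_op_model; apply: (le_trans (sqnorm_square_trig_le _ _)).
rewrite [leLHS]mulrA !mulr_sumr; apply: ler_sum => k _.
set s := symbol_cst c * growth R d (w k t).
have h : normsq (diff_coef alpha c (w k t) (sampled_coeff t k)) <=
    s * (K%:R^-1 ^+ 2 * (((2 * pi) ^+ 2)^-1 * ratio (w k t) ^+ 2)).
  apply: (le_trans (normsq_diff_coef_le c Halpha _ _)).
  rewrite -cnorm_amplitude [X in _ <= _ * (_ * X)]cnorm_sqr cnorm_sqr/=.
  by rewrite !(normsqZ K%:R^-1) -mulrDr.
have pK0 : 0 <= (2 * pi) ^+ 2 * K%:R :> R by rewrite mulr_ge0// sqr_ge0.
apply: (le_trans (ler_wpM2l pK0 h)); rewrite le_eqVlt; apply/orP; left; apply/eqP.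
have K0' : K%:R != 0 :> R by rewrite pnatr_eq0 -lt0n.
have := gt_eqF (pi_gt0 R); rewrite /s; move: pi => p p0.
by field; rewrite K0' p0.
Qed.

End SampledModel.

(** * The expected minimum *)
Section ExpectedMinimum.
Context (R : realType) (disp : measure_display) (T : measurableType disp)
  (P : probability T R).
Variables (f : R * R -> R * R) (fhat : int * int -> R[i] * R[i]).
Hypothesis Hf : fourier_expansion f fhat.
Variable S : R.
Hypothesis HS : (\esum_(w in [set: int * int]) (cnorm (fhat w))%:E = S%:E)%E.
Variables (x eps : {RV P >-> (R * R)%type}) (sigma : R).
Hypothesis Hx : forall t, square (x t).
Hypothesis Hindep : independent P x eps.
Hypothesis Heps1 : ('E_P[fun t => (eps t).1] = 0)%E.
Hypothesis Heps2 : ('E_P[fun t => (eps t).2] = 0)%E.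
Hypothesis Hsigma : ('E_P[fun t => (enorm (eps t) ^+ 2)%R] = (sigma ^+ 2)%:E)%E.

Lemma integrable_enorm_field : P.-integrable setT (EFin \o (fun t => enorm (f (x t)) ^+ 2)).
Proof.
have [_ i1] := square_integrable_field1 Hf HS Hx.
have [_ i2] := square_integrable_field2 Hf HS Hx.
have -> : (fun t => enorm (f (x t)) ^+ 2) =
    (fun t => field1 f (x t) ^+ 2 + field2 f (x t) ^+ 2).
  by apply/funext => t; rewrite enorm_sqr field1E// field2E.
exact: (integrableD measurableT i1 i2).
Qed.

Lemma expectation_enorm_field :
  'E_P[fun t => (enorm (f (x t)) ^+ 2)%R]%E = (\int[P]_t (enorm (f (x t)) ^+ 2))%:E.
Proof.
rewrite unlock /Rintegral fineK//.
exact: (integrable_fin_num measurableT integrable_enorm_field).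
Qed.

Variables (K : nat) (lambda : R) (d M : nat) (alpha : 'I_M -> nat * nat)
  (c : 'I_M -> R[i] * R[i]).
Hypothesis K0 : (0 < K)%N.
Hypothesis lambda0 : 0 <= lambda.
Hypothesis Halpha : forall m, ((alpha m).1 + (alpha m).2 <= d)%N.

Let Risk := @risk disp T R P lambda (diff_op alpha c) f x eps K.

Lemma risk_ge0 w b : (0 <= Risk w b)%E.
Proof.
rewrite /Risk (riskE Hf HS Hx Hindep Heps1 Heps2 Hsigma) lee_fin.
apply: addr_ge0; [apply: addr_ge0|apply: mulr_ge0 => //].
- by apply: Rintegral_ge0 => t _; exact: misfit_ge0.
- exact: sqr_ge0.
- by apply: Rintegral_ge0 => y _; rewrite Re_conjM normsq_ge0.
Qed.

Variables (rho : int * int -> R) (V B : R).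
Hypothesis rpos : forall v, 0 < rho v.
Hypothesis ratioV : (Erho rho (fun v => ratio fhat rho v ^+ 2)%R <= V%:E)%E.
Hypothesis penaltyVB : (Erho rho (fun v => ratio fhat rho v ^+ 2
  * (symbol_cst c * growth R d v))%R <= (V * B)%:E)%E.
Context (d' : measure_display) (T' : measurableType d') (Q : probability T' R)
  (w : 'I_K -> T' -> int * int).
Hypothesis iidw : iid Q rho w.

Lemma integral_min_risk_le :
  (\int[Q]_t ereal_inf [set Risk (w ^~ t) b | b in setT] <=
   (K%:R^-1 * (((2 * pi) ^+ 2)^-1 * V - \int[P]_t (enorm (f (x t)) ^+ 2))
    + (sigma ^+ 2 + lambda * (V * B)))%:E)%E.
Proof.
pose N v := ratio fhat rho v ^+ 2 * (symbol_cst c * growth R d v).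
pose mis (p : T' * T) := (misfit f (w^~ p.1) (sampled_coeff fhat rho w p.1) (x p.2))%:E.
have N0 v : 0 <= N v.
  rewrite /N mulr_ge0 ?sqr_ge0// mulr_ge0 ?symbol_cst_ge0//.
  by rewrite /growth addr_ge0// addr_ge0// exprn_ge0.
have mis0 p : (0 <= mis p)%E by rewrite lee_fin misfit_ge0.
have mx : measurable_fun setT x := measurable_funP x.
have mmis : measurable_fun setT mis.
  apply/measurable_EFinP; apply: (measurable_misfit_sample fhat iidw mx).
    exact: measurable_field1 Hf.
  exact: measurable_field2 Hf.
pose pen t := sigma ^+ 2 + lambda * (K%:R^-1 * \sum_k N (w k t)).
have iN k : Q.-integrable setT (EFin \o (fun t => N (w k t))).
  exact: (integrable_sample iidw k N0 penaltyVB).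
have iS : Q.-integrable setT (EFin \o (fun t => \sum_k N (w k t))).
  have -> : EFin \o (fun t => \sum_k N (w k t)) = (fun t => \sum_k (N (w k t))%:E)%E.
    by apply/funext => t; rewrite /= sumEFin.
  by apply: integrable_sum => // k _; exact: iN.
have iKS : Q.-integrable setT (EFin \o (fun t => K%:R^-1 * \sum_k N (w k t))).
  exact: (integrableZl measurableT K%:R^-1 iS).
have ilKS : Q.-integrable setT
    (EFin \o (fun t => lambda * (K%:R^-1 * \sum_k N (w k t)))).
  exact: (integrableZl measurableT lambda iKS).
have QT : (Q setT < +oo)%E by rewrite probability_setT ltry.
have isig := square_integrable_integrable measurableT QT
  (square_integrable_cst measurableT QT (sigma ^+ 2)).
have ipen : Q.-integrable setT (EFin \o pen) := integrableD measurableT isig ilKS.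
have S0 t : 0 <= \sum_k N (w k t) by apply: sumr_ge0 => k _; exact: N0.
have pen0 t : 0 <= pen t.
  by rewrite addr_ge0 ?sqr_ge0// mulr_ge0// mulr_ge0 ?invr_ge0.
(* compare the infimum with the value at the sampled coefficients *)
have step1 : (\int[Q]_t ereal_inf [set Risk (w ^~ t) b | b in setT] <=
    \int[Q]_t (\int[P]_s mis (t, s) + (pen t)%:E))%E.
  apply: le_integral_of_ge0 => t.
    by apply: le_ereal_inf_tmp => _ [b _ <-]; exact: risk_ge0.
  apply: ge_ereal_inf; exists (Risk (w^~ t) (sampled_coeff fhat rho w t)).
    by exists (sampled_coeff fhat rho w t).
  rewrite /Risk (riskE Hf HS Hx Hindep Heps1 Heps2 Hsigma).
  rewrite -addrA EFinD; apply: leeD.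
    rewrite /Rintegral fineK//; apply: (integrable_fin_num measurableT).
    exact: (integrable_misfit Hf HS Hx).
  rewrite lee_fin lerD2l ler_wpM2l//.
  exact: sqnorm_sample_le.
apply: (le_trans step1).
have mP : measurable_fun setT (fun t => \int[P]_s mis (t, s))%E.
  exact: (measurable_fun_fubini_tonelli_F mis).
rewrite ge0_integralD//; first last.
- by apply/measurable_EFinP; apply/measurable_EFinP; case/integrableP: ipen.
- by move=> t _; rewrite lee_fin.
- by move=> t _; apply: integral_ge0.
rewrite EFinD; apply: leeD.
  rewrite (fubini_tonelli mis)//.
  have iE := integrable_enorm_field.
  have icst (r : R) : P.-integrable setT (EFin \o (fun=> r)).
    have PT : (P setT < +oo)%E by rewrite probability_setT ltry.
    exact: (square_integrable_integrable measurableT PT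
      (square_integrable_cst measurableT PT r)).
  pose G := ((2 * pi) ^+ 2)^-1 * V.
  have iB : P.-integrable setT (EFin \o (fun s => G - enorm (f (x s)) ^+ 2)).
    exact: (integrableB measurableT (icst G) iE).
  have iKB : P.-integrable setT
      (EFin \o (fun s => K%:R^-1 * (G - enorm (f (x s)) ^+ 2))).
    exact: (integrableZl measurableT K%:R^-1 iB).
  have -> : K%:R^-1 * (G - \int[P]_t (enorm (f (x t)) ^+ 2)) =
      \int[P]_s (K%:R^-1 * (G - enorm (f (x s)) ^+ 2)).
    by rewrite (RintegralZl _ measurableT iB) (RintegralB measurableT (icst G) iE) Rintegral_cstP.
  rewrite /Rintegral fineK; last exact: (integrable_fin_num measurableT iKB).
  apply: le_integral_of_ge0 => s; first exact: integral_ge0.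
  exact: (integral_misfit_sample Hf rpos K0 iidw ratioV (Hx s)).
rewrite -[leLHS]fineK; last exact: (integrable_fin_num measurableT ipen).
rewrite lee_fin -[leLHS]/(\int[Q]_t pen t).
rewrite (RintegralD measurableT isig ilKS) Rintegral_cstP lerD2l.
rewrite (RintegralZl _ measurableT iKS) ler_wpM2l//.
rewrite (RintegralZl _ measurableT iS) Rintegral_sum//.
have -> : V * B = K%:R^-1 * \sum_(k < K) (V * B).
  by rewrite sumr_const card_ord -[X in _ = _ * X]mulr_natl mulrA mulVf ?mul1r//
    pnatr_eq0 -lt0n.
rewrite ler_wpM2l ?invr_ge0//; apply: ler_sum => k _.
exact: (Rintegral_sample_le iidw k N0 penaltyVB).
Qed.

End ExpectedMinimum.

Local Close Scope complex_scope.

Theorem mainTheorem1 (R : realType)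
    (f : R * R -> R * R) (fhat : int * int -> R[i] * R[i])
    (Hf : fourier_expansion f fhat)
    (disp : measure_display) (T : measurableType disp) (P : probability T R)
    (x eps : {RV P >-> (R * R)%type}) (sigma : R)
    (Hx : forall t, square (x t))
    (Hindep : independent P x eps)
    (Heps1 : ('E_P[fun t => (eps t).1] = 0)%E)
    (Heps2 : ('E_P[fun t => (eps t).2] = 0)%E)
    (Hsigma : ('E_P[fun t => (enorm (eps t) ^+ 2)%R] = (sigma ^+ 2)%:E)%E)
    (K : nat) (HK : (1 <= K)%N) (lambda : R) (Hlambda : 0 <= lambda)
    (d M : nat) (alpha : 'I_M -> nat * nat) (c : 'I_M -> R[i] * R[i])
    (Halpha : forall m, ((alpha m).1 + (alpha m).2 <= d)%N)
    (C : R) (HC : 0 < C)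
    (Hadm : admissible d C (fourier_law fhat)) :
  let Risk := @risk disp T R P lambda (diff_op alpha c) f x eps K in
  (forall w, exists b0, forall b, (Risk w b0 <= Risk w b)%E) /\
  exists Cbar : R,
    [/\ 0 < Cbar,
        forall rho, admissible d C rho ->
          forall (disp' : measure_display) (T' : measurableType disp')
                 (Q : probability T' R) (w : 'I_K -> T' -> int * int),
            iid Q rho w ->
            (\int[Q]_t ereal_inf [set Risk (w ^~ t) b | b in setT]
               <= error_bound P lambda Cbar sigma f fhat x K rho)%E &
        forall rho, admissible d C rho ->
          (error_bound P lambda Cbar sigma f fhat x K (fourier_law fhat)
             <= error_bound P lambda Cbar sigma f fhat x K rho)%E].
Proof.
move=> Risk.
have [S [S0 HS cpos]] := fourier_law_mass Hadm.
have K0' : 0 < K%:R^-1 :> R by rewrite invr_gt0 ltr0n.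
split=> [w|]; first exact: (risk_min Hf HS Hx Hindep Heps1 Heps2 Hsigma alpha c w Hlambda).
pose B := penalty_cst c C; have B0 : 0 < B := penalty_cst_gt0 c C.
have pi2 : 0 < (2 * pi) ^+ 2 :> R by rewrite exprn_gt0// mulr_gt0// pi_gt0.
have KR : 0 < K%:R :> R by rewrite ltr0n.
(* B enters through lambda * V * B; the prefactor undoes the division by
   (2 pi)^2 K in the bound, and 1 ensures positivity *)
exists ((2 * pi) ^+ 2 * K%:R * B + 1).
have Cbar0 : 0 < (2 * pi) ^+ 2 * K%:R * B + 1 by rewrite addr_gt0 ?ltr01// mulr_gt0// mulr_gt0.
have coef0 : 0 < (1 + lambda * ((2 * pi) ^+ 2 * K%:R * B + 1)) / ((2 * pi) ^+ 2 * K%:R).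
  apply: divr_gt0; last exact: mulr_gt0.
  by have := mulr_ge0 Hlambda (ltW Cbar0); lra.
split=> //.
- move=> rho Hrho d' T' Q w iidw.
  have [rpos _ _] := Hrho.
  have rho0 v : 0 <= rho v by rewrite ltW.
  rewrite /error_bound (expectation_enorm_field Hf HS Hx).
  have E4 : Erho rho (fun v => (cnorm (fhat v) ^+ 4 / rho v ^+ 4)%R) =
      Erho rho (fun v => (ratio fhat rho v ^+ 4)%R).
    by congr Erho; apply/funext => v; rewrite /ratio [RHS]expr_div_n.
  rewrite E4.
  have r0 v : 0 <= ratio fhat rho v by rewrite divr_ge0// cnorm_ge0.
  (* the fourth moment is positive, hence so is the number V below *)
  have low : ((S ^+ 4)%:E <= Erho rho (fun v => (ratio fhat rho v ^+ 4)%R))%E.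
    apply: Erho_fourth_power_ge => //; first by rewrite (admissible_sum1 Hrho).
    by rewrite -HS; apply: eq_esum => v _; rewrite /ratio divfK// gt_eqF.
  case W4 : (Erho _ _) low => [W| |] low; last 2 first.
  - by rewrite /= gt0_muley ?lte_fin//= leey.
  - by [].
  have W0 : 0 < W by move: low; rewrite lee_fin; apply: lt_le_trans; rewrite exprn_gt0.
  pose V := Num.sqrt W.
  have V0 : 0 < V by rewrite sqrtr_gt0.
  have VW : V ^+ 2 = W by rewrite sqr_sqrtr// ltW.
  have r4 : (Erho rho (fun v => (ratio fhat rho v ^+ 4)%R) <= (V ^+ 2)%:E)%E.
    by rewrite W4 VW.
  have r2 : (Erho rho (fun v => (ratio fhat rho v ^+ 2)%R) <= V%:E)%E.
    have one : (Erho rho (fun=> 1 ^+ 2)%R <= (1 ^+ 2)%:E)%E.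
      by rewrite expr1n (admissible_sum1 Hrho).
    have := Erho_cauchy_schwarz rho0 V0 ltr01 r4 one; rewrite mulr1.
    by under [X in Erho rho X]eq_fun do rewrite mulr1.
  have rp := Erho_cauchy_schwarz rho0 V0 B0 r4 (Erho_symbol_bound c HC Hrho).
  apply: (le_trans (integral_min_risk_le Hf HS Hx Hindep Heps1 Heps2 Hsigma HK
    Hlambda Halpha rpos r2 rp iidw)).
  rewrite -[sqrte _]/(V%:E) -!EFinM -!EFinD lee_fin.
  have -> : (1 + lambda * ((2 * pi) ^+ 2 * K%:R * B + 1)) / ((2 * pi) ^+ 2 * K%:R) * V
      = K%:R^-1 * (((2 * pi) ^+ 2)^-1 * V) + lambda * (V * B)
        + lambda * (V / ((2 * pi) ^+ 2 * K%:R)).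
    move: ((2 * pi) ^+ 2) pi2 => p p0; field.
    by rewrite !gt_eqF.
  have : 0 <= lambda * (V / ((2 * pi) ^+ 2 * K%:R)).
    by apply: mulr_ge0 => //; apply/ltW/divr_gt0 => //; exact: mulr_gt0.
  lra.
- move=> rho Hrho; rewrite /error_bound.
  apply: leeD2r; apply: leeD2r; apply: lee_wpmul2l; first by rewrite lee_fin ltW.
  have [rpos _ _] := Hrho.
  rewrite lee_sqrt; first exact: (Erho_fourth_power_min Hadm Hrho).
  apply: esum_ge0 => v _; by rewrite lee_fin mulr_ge0 ?ltW// divr_gt0// exprn_gt0.
Qed.
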